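(* Let $K$ be a field and $E$ a directed graph (of arbitrary cardinality). Then all (two-sided) ideals of $L_K(E)$ are homogeneous if and only if $E$ satisfies Condition (K).
   Context: A (directed) graph $E=(E^0,E^1,r,s)$ consists of two disjoint sets $E^0$ (vertices), $E^1$ (edges) and maps $r,s:E^1\to E^0$ (range and source). A vertex $v$ is a sink if $s^{-1}(v)=\varnothing$, and an infinite emitter if $s^{-1}(v)$ is infinite. The double $\widehat E$ of $E$ has $\widehat E^0=E^0$ and $\widehat E^1=E^1\sqcup\{e^*\mid e\in E^1\}$, with $r(e^* )=s(e)$, $s(e^* )=r(e)$. Paths are written left to right: $e_1e_2\cdots e_n$ with $r(e_i)=s(e_{i+1})$; there is also a path $v$ of length zero at each vertex $v$. The path algebra $K\widehat E$ is the $K$-vector space with basis all paths in $\widehat E$, with multiplication given by concatenation when range and source match, and $0$ otherwise. The Leavitt path algebra $L_K(E)$ is the quotient of $K\widehat E$ by the ideal generated by: $e^*e-r(e)$ for all $e\in E^1$; $e^*f$ for all distinct $e,f\in E^1$; and $v-\sum_{e\in E^1,\,s(e)=v}ee^*$ for every $v\in E^0$ which is neither a sink nor an infinite emitter. It is $\mathbb Z$-graded, with vertices of degree $0$, each $e\in E^1$ of degree $1$ and each $e^*$ of degree $-1$; ''homogeneous'' ideals are those which contain all homogeneous components of each of their elements with respect to this grading. A path $p=e_1e_2\cdots e_n$ ($n\ge1$) in $E$ is closed if $r(e_n)=s(e_1)$, in which case it is based at $s(e_1)$; a closed path $p$ is simple if $s(e_i)\ne s(e_1)$ for all $i=2,\dots,n$.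 The graph $E$ satisfies Condition (K) if no vertex of $E$ is the base of precisely one simple closed path in $E$. *)

(* Defs.v *)
From HB Require Import structures.
From mathcomp Require Import all_boot all_algebra.
From mathcomp Require Import finmap boolp classical_sets functions cardinality.
From mathcomp Require Import fsbigop.
From mathcomp.multinomials Require Import monalg.

Set Implicit Arguments.
Unset Strict Implicit.
Unset Printing Implicit Defensive.

Import GRing.Theory.
Local Open Scope classical_set_scope.
Local Open Scope ring_scope.

(* Vertices and edges are arbitrary types: no finiteness, countability or
   decidability is assumed. *)
Record digraph : Type := Digraph {
  vertex : Type;
  edge : Type;
  src : edge -> vertex;
  rng : edge -> vertex }.

(* Classical equality and choice on the vertices and edges, so that paths can
   index the free modules {malg K[_]}. *)
HB.instance Definition _ (G : digraph) := gen_eqMixin (vertex G).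
HB.instance Definition _ (G : digraph) := gen_choiceMixin (vertex G).
HB.instance Definition _ (G : digraph) := gen_eqMixin (edge G).
HB.instance Definition _ (G : digraph) := gen_choiceMixin (edge G).

Section Paths.
Variable G : digraph.
Implicit Types (v : vertex G) (s : seq (edge G)).

Fixpoint walk v s : bool :=
  if s is e :: s' then (src e == v) && walk (rng e) s' else true.

Definition walk_end v s : vertex G := last v (map (@rng G) s).

Lemma walk_cat v s1 s2 : walk v (s1 ++ s2) = walk v s1 && walk (walk_end v s1) s2.
Proof. by elim: s1 v => //= e s1 IHs v; rewrite IHs andbA. Qed.

(* The starting vertex is part of the data because of the paths of length 0. *)
Record gpath : Type := GPath {
  gpath_val : vertex G * seq (edge G);
  _ : walk gpath_val.1 gpath_val.2 }.

HB.instance Definition _ := [isSub for gpath_val].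
HB.instance Definition _ := [Choice of gpath by <:].

Definition psrc (p : gpath) : vertex G := (gpath_val p).1.
Definition psteps (p : gpath) : seq (edge G) := (gpath_val p).2.
Definition prng (p : gpath) : vertex G := walk_end (psrc p) (psteps p).

Definition vpath v : gpath := @GPath (v, [::]) isT.

Fact epath_subproof (e : edge G) : walk (src e) [:: e].
Proof. by rewrite /= eqxx. Qed.
Definition epath (e : edge G) : gpath := @GPath (src e, [:: e]) (epath_subproof e).

(* Concatenation, written left to right: None when prng p <> psrc q; by
   pcat_some the insub never fails when prng p = psrc q. *)
Definition pcat (p q : gpath) : option gpath :=
  if prng p == psrc q then insub (psrc p, psteps p ++ psteps q) else None.

Lemma pcat_some p q : prng p = psrc q ->
  omap gpath_val (pcat p q) = Some (psrc p, psteps p ++ psteps q).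
Proof.
case: p q => [[v s] vs] [[w t] wt] /=; rewrite /prng /psrc /= => pq.
rewrite /pcat /prng /psrc /psteps /= pq eqxx.
by case: insubP => [r _ /= <-//|]; rewrite /= walk_cat vs pq wt.
Qed.

Definition sink v : Prop := [set e : edge G | src e = v] = set0.
Definition infinite_emitter v : Prop := infinite_set [set e : edge G | src e = v].

(* s is a closed path of positive length based at v that does not pass through
   v in between. *)
Definition simple_closed_path v s : Prop :=
  [/\ s <> [::], walk v s, walk_end v s = v
    & forall e, e \in behead s -> src e <> v].

Definition condition_K : Prop :=
  forall v, ~ exists! s, simple_closed_path v s.

End Paths.

(* Two-sided ring ideals; mul need not have an identity. No closure under
   scalars is required: path algebras and Leavitt path algebras over a field
   have local units, so there every such ideal is a subspace. *)
Record two_sided_ideal (A : zmodType) (mul : A -> A -> A) (I : set A) : Prop :=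
  TwoSidedIdeal {
    ideal0 : I 0;
    idealB : forall x y, I x -> I y -> I (x - y);
    idealMl : forall r x, I x -> I (mul r x);
    idealMr : forall r x, I x -> I (mul x r) }.

Definition generated_ideal (A : zmodType) (mul : A -> A -> A) (S : set A) : set A :=
  \bigcap_(J in [set J | two_sided_ideal mul J /\ S `<=` J]) J.

Lemma generated_idealP (A : zmodType) (mul : A -> A -> A) (S : set A) :
  two_sided_ideal mul (generated_ideal mul S).
Proof.
split=> [|x y Ix Iy|r x Ix|r x Ix] J [idJ SJ]; first exact: ideal0 idJ.
- by apply: (idealB idJ); [apply: Ix|apply: Iy].
- by apply: (idealMl idJ); apply: Ix.
- by apply: (idealMr idJ); apply: Ix.
Qed.

Section PathAlgebra.
Variables (K : fieldType) (G : digraph).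

Definition path_alg := {malg K[gpath G]}.
HB.instance Definition _ := GRing.Lmodule.on path_alg.

Definition pmul_basis (c : K) (p q : gpath G) : path_alg :=
  if pcat p q is Some r then << c *g r >> else 0.

Definition pmul (a b : path_alg) : path_alg :=
  \sum_(p <- msupp a) \sum_(q <- msupp b) pmul_basis (a@_p * b@_q) p q.

Definition pvert (v : vertex G) : path_alg := << vpath v >>.
Definition pedge (e : edge G) : path_alg := << epath e >>.

Lemma pmul_basis0 p q : pmul_basis 0 p q = 0.
Proof. by rewrite /pmul_basis; case: pcat => // r; rewrite raddf0. Qed.

Lemma pmul_basisB c d p q :
  pmul_basis (c - d) p q = pmul_basis c p q - pmul_basis d p q.
Proof. by rewrite /pmul_basis; case: pcat => [r|]; rewrite ?raddfB ?subr0. Qed.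

Lemma pmulEw (S T : {fset gpath G}) a b :
  (msupp a `<=` S)%fset -> (msupp b `<=` T)%fset ->
  pmul a b = \sum_(p <- S) \sum_(q <- T) pmul_basis (a@_p * b@_q) p q.
Proof.
move=> aS bT; rewrite /pmul (big_fset_incl _ aS) /=; last first.
  move=> p _ /mcoeff_outdom ap; rewrite big1// => q _.
  by rewrite ap mul0r pmul_basis0.
apply: eq_bigr => p _; apply: (big_fset_incl _ bT) => q _ /mcoeff_outdom bq.
by rewrite bq mulr0 pmul_basis0.
Qed.

Lemma pmulU c d p q :
  pmul << c *g p >> << d *g q >> = pmul_basis (c * d) p q.
Proof.
rewrite (@pmulEw [fset p]%fset [fset q]%fset) ?msuppU_le//.
by rewrite !big_seq_fset1 !mcoeffUU.
Qed.

Lemma pmulBl a a' b : pmul (a - a') b = pmul a b - pmul a' b.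
Proof.
pose S := (msupp a `|` msupp a' `|` msupp (a - a'))%fset.
rewrite !(@pmulEw S (msupp b)) ?fsubsetUr// /S; last 2 first.
- by rewrite -fsetUA fsetUCA fsubsetUl.
- by rewrite -fsetUA fsubsetUl.
rewrite -sumrB; apply: eq_bigr => p _; rewrite -sumrB; apply: eq_bigr => q _.
by rewrite raddfB mulrBl pmul_basisB.
Qed.

Lemma pmulBr a b b' : pmul a (b - b') = pmul a b - pmul a b'.
Proof.
pose S := (msupp b `|` msupp b' `|` msupp (b - b'))%fset.
rewrite !(@pmulEw (msupp a) S) ?fsubsetUr// /S; last 2 first.
- by rewrite -fsetUA fsetUCA fsubsetUl.
- by rewrite -fsetUA fsubsetUl.
rewrite -sumrB; apply: eq_bigr => p _; rewrite -sumrB; apply: eq_bigr => q _.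
by rewrite raddfB mulrBr pmul_basisB.
Qed.

End PathAlgebra.

(* inl e is the edge e and inr e is the ghost edge e^*. *)
Definition double_graph (E : digraph) : digraph :=
  @Digraph (vertex E) (edge E + edge E)%type
    (fun x => match x with inl e => src e | inr e => rng e end)
    (fun x => match x with inl e => rng e | inr e => src e end).

Section LeavittPathAlgebra.
Variables (K : fieldType) (E : digraph).

Local Notation A := (path_alg K (double_graph E)).
Local Notation "a ** b" := (@pmul K (double_graph E) a b) (at level 40).
Local Notation vtx v := (@pvert K (double_graph E) v).
Local Notation real e := (@pedge K (double_graph E) (inl e)).
Local Notation ghost e := (@pedge K (double_graph E) (inr e)).

Inductive lpa_relation : set A :=
| CK1_eq (e : edge E) : lpa_relation (ghost e ** real e - vtx (rng e))
| CK1_neq (e f : edge E) : e <> f -> lpa_relation (ghost e ** real f)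
| CK2 (v : vertex E) : ~ sink v -> ~ infinite_emitter v ->
    lpa_relation
      (vtx v - \sum_(e \in [set e : edge E | src e = v]) (real e ** ghost e)).

Definition lpa_ideal : set A := generated_ideal (@pmul K (double_graph E)) lpa_relation.

Definition in_lpa_ideal : {pred A} := fun a => `[< lpa_ideal a >].

Fact lpa_ideal_zmod_closed : zmod_closed in_lpa_ideal.
Proof.
have idI := generated_idealP (@pmul K (double_graph E)) lpa_relation.
split=> [|x y /asboolP Ix /asboolP Iy]; apply/asboolP; first exact: ideal0 idI.
exact: idealB idI _ _ Ix Iy.
Qed.
HB.instance Definition _ :=
  GRing.isZmodClosed.Build A in_lpa_ideal lpa_ideal_zmod_closed.

Definition lpa : Type := Quotient.quot in_lpa_ideal.
HB.instance Definition _ := GRing.Zmodule.on lpa.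

Definition lpa_pi (a : A) : lpa := (\pi_(Quotient.quot in_lpa_ideal) a)%qT.
Definition lpa_repr (x : lpa) : A := repr (x : Quotient.quot in_lpa_ideal).

Definition lpa_mul (x y : lpa) : lpa := lpa_pi (lpa_repr x ** lpa_repr y).

Lemma lpa_piK : cancel lpa_repr lpa_pi.
Proof. by move=> x; rewrite /lpa_pi /lpa_repr reprK. Qed.

Lemma lpa_pi_eq a b : lpa_pi a = lpa_pi b <-> lpa_ideal (a - b).
Proof.
have E1 := Quotient.idealrBE in_lpa_ideal a b.
split=> [ab|/asboolP Iab].
  by apply/asboolP; have: a - b \in in_lpa_ideal by rewrite E1; apply/eqP.
by apply/eqP; have: a - b \in in_lpa_ideal by []; rewrite E1.
Qed.

Lemma lpa_piM a b : lpa_pi (a ** b) = lpa_mul (lpa_pi a) (lpa_pi b).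
Proof.
have idI := generated_idealP (@pmul K (double_graph E)) lpa_relation.
have Irepr c : lpa_ideal (c - lpa_repr (lpa_pi c)).
  by apply/lpa_pi_eq; rewrite lpa_piK.
apply/lpa_pi_eq; rewrite -(subrKA (lpa_repr (lpa_pi a) ** b)) -pmulBl -pmulBr.
rewrite -[X in _ + X]opprK; apply: (idealB idI); first exact: idealMr idI _ _ (Irepr a).
rewrite -sub0r; apply: (idealB idI); first exact: ideal0 idI.
exact: idealMl idI _ _ (Irepr b).
Qed.

Definition edge_degree (x : edge (double_graph E)) : int :=
  if x is inl _ then 1 else -1.
Definition path_degree (p : gpath (double_graph E)) : int :=
  \sum_(x <- psteps p) edge_degree x.

Definition lpa_homogeneous (n : int) : set lpa :=
  [set x | exists2 a : A,
     (forall p, p \in msupp a -> path_degree p = n) & x = lpa_pi a].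

(* For every element of I, written as a finite sum of homogeneous elements of
   pairwise distinct degrees, all the summands are in I. *)
Definition homogeneous_ideal (I : set lpa) : Prop :=
  forall (s : seq int) (x : int -> lpa), uniq s ->
    (forall n, n \in s -> lpa_homogeneous n (x n)) ->
    I (\sum_(n <- s) x n) -> forall n, n \in s -> I (x n).

End LeavittPathAlgebra.

(* Main.v *)
(* Let [I] be an ideal and [J] the largest graded ideal inside it.

   If (K) holds, then [I = J].  First, an [x] in [I] is reduced to linear
   combinations of real paths.  Let [x] end at [w] and suppose that [x e] lies in
   [J] for every edge [e] leaving [w].  For a finite set [F] of edges leaving [w]
   and the idempotent [p = w - sum_(e in F) e e^*], take [F] so large that
   [x p = y p] with [y] a combination of real paths.  If [y <> 0], left
   multiplication by [a^*], for a shortest path [a] of [y], shows that every edge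
   [e] outside [F] leaving [w] is in [J]; hence [p a^* x p] is congruent modulo [J]
   to a nonzero multiple of [p], so that [p], and with it [x], is in [J].
   Second, a combination of real paths becomes, after multiplication by [a^*],
   a vertex [w] plus a combination of closed paths at [w].  If this has a summand
   [g], (K) yields a simple closed path [c] at [w] that is not a prefix of [g];
   then [c^* (-) c] fixes [w] and kills [g], and induction on the number of
   summands gives [w] in [J].

   If instead [c] is the only simple closed path at [v], then [c^oo] is the only
   infinite path that starts at [v] and meets [v] infinitely often.  So [v - c]
   annihilates the module spanned by the infinite paths that meet [v] infinitely
   often, while [v] does not, and the annihilator is not homogeneous. *)
From HB Require Import structures.
Require Import Defs.
From mathcomp Require Import all_boot all_algebra.
From mathcomp Require Import finmap boolp classical_sets functions cardinality.
From mathcomp Require Import fsbigop zify.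
From mathcomp.multinomials Require Import monalg.

Set Implicit Arguments.
Unset Strict Implicit.
Unset Printing Implicit Defensive.

Import GRing.Theory.
Local Open Scope ring_scope.

(** * Path algebras *)

Section Ideals.
Variables (A : zmodType) (mul : A -> A -> A) (I : set A).
Hypothesis idI : two_sided_ideal mul I.

Lemma idealN x : I x -> I (- x).
Proof. by move=> Ix; rewrite -sub0r; apply: (idealB idI) => //; apply: ideal0 idI. Qed.

Lemma idealD x y : I x -> I y -> I (x + y).
Proof. by move=> Ix Iy; rewrite -[y]opprK; apply: (idealB idI) => //; apply: idealN. Qed.

Lemma ideal_sum (T : Type) (r : seq T) (P : pred T) (F : T -> A) :
  (forall i, P i -> I (F i)) -> I (\sum_(i <- r | P i) F i).
Proof.
by move=> IF; elim/big_ind: _ => //; [exact: ideal0 idI|exact: idealD].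
Qed.

Lemma ideal_sum_seq (T : eqType) (r : seq T) (F : T -> A) :
  (forall i, i \in r -> I (F i)) -> I (\sum_(i <- r) F i).
Proof. by move=> IF; rewrite big_seq; apply: ideal_sum. Qed.

End Ideals.

(** Path algebras and their quotients have no unit in general, so the product is treated as a bare
    biadditive map, with additive generators [g]. *)
Section Biadditive.
Variables (A : zmodType) (mul : A -> A -> A) (T : Type) (g : T -> A).
Hypothesis mulBl : forall a a' b, mul (a - a') b = mul a b - mul a' b.
Hypothesis mulBr : forall a b b', mul a (b - b') = mul a b - mul a b'.
Hypothesis gen_ind : forall P : A -> Prop,
  P 0 -> (forall a b, P a -> P b -> P (a + b)) -> (forall x, P (g x)) ->
  forall a, P a.

Lemma biadd0l b : mul 0 b = 0.
Proof. by rewrite -[X in mul X](subrr 0) mulBl subrr. Qed.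

Lemma biadd0r a : mul a 0 = 0.
Proof. by rewrite -[X in mul _ X](subrr 0) mulBr subrr. Qed.

Lemma biaddDl a b c : mul (a + b) c = mul a c + mul b c.
Proof. by rewrite -{1}[b]opprK mulBl -(sub0r b) mulBl biadd0l sub0r opprK. Qed.

Lemma biaddDr a b c : mul c (a + b) = mul c a + mul c b.
Proof. by rewrite -{1}[b]opprK mulBr -(sub0r b) mulBr biadd0r sub0r opprK. Qed.

Lemma associative_gen :
  (forall x y z, mul (g x) (mul (g y) (g z)) = mul (mul (g x) (g y)) (g z)) ->
  associative mul.
Proof.
move=> gA a b c.
elim/gen_ind: a => [|a a' IHa IHa'|x]; rewrite ?biadd0l // ?biaddDl ?IHa ?IHa' //.
elim/gen_ind: b => [|b b' IHb IHb'|y];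
  rewrite ?(biadd0l, biadd0r) // ?(biaddDl, biaddDr) ?IHb ?IHb' //.
elim/gen_ind: c => [|c c' IHc IHc'|z]; rewrite ?biadd0r // ?biaddDr ?IHc ?IHc' //.
Qed.

End Biadditive.

Section PathAlgebraTheory.
Variables (K : fieldType) (G : digraph).
Implicit Types (v w : vertex G) (s t : seq (edge G)) (k l : K) (a b c : path_alg K G).
Local Notation "a ** b" := (@pmul K G a b) (at level 40).

Lemma pmul0l a : 0 ** a = 0.
Proof. exact: biadd0l (@pmulBl K G) a. Qed.

Lemma pmul0r a : a ** 0 = 0.
Proof. exact: biadd0r (@pmulBr K G) a. Qed.

Lemma pmulDl a b c : (a + b) ** c = a ** c + b ** c.
Proof. exact: biaddDl (@pmulBl K G) a b c. Qed.

Lemma pmulDr a b c : c ** (a + b) = c ** a + c ** b.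
Proof. exact: biaddDr (@pmulBr K G) a b c. Qed.

Lemma walk_end_cat v s t : walk_end v (s ++ t) = walk_end (walk_end v s) t.
Proof. by rewrite /walk_end map_cat last_cat. Qed.

(* The multiple by [k] of the path [s] starting at [v], and the junk value 0
   when [s] is not such a path. *)
Definition mon k v s : path_alg K G :=
  if insub (v, s) is Some p then << k *g p >> else 0.

Lemma mon_gpath k (p : gpath G) : << k *g p >> = mon k (psrc p) (psteps p).
Proof.
rewrite /mon; case: insubP => [q _ /= Hq|].
  by congr mkmalgU; apply: val_inj; apply: etrans (esym Hq); case: (p) => [[]].
by case: (p) => [[u s] /= h] /negP.
Qed.

Lemma mon_nwalk k v s : ~~ walk v s -> mon k v s = 0.
Proof. by move=> h; rewrite /mon insubN. Qed.

Lemma monP k v s : walk v s ->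
  exists p, [/\ psrc p = v, psteps p = s & mon k v s = << k *g p >>].
Proof.
by move=> h; exists (@GPath G (v, s) h); split=> //; rewrite mon_gpath.
Qed.

Lemma monD k l v s : mon (k + l) v s = mon k v s + mon l v s.
Proof.
by rewrite /mon; case: insub => [p|]; rewrite ?addr0 // raddfD.
Qed.

(** The junk value 0 spares all path hypotheses: if one factor is not a path, a matching
    concatenation is not a path either, and both sides vanish. *)
Lemma mon_mul k l v w s t :
  mon k v s ** mon l w t = if walk_end v s == w then mon (k * l) v (s ++ t) else 0.
Proof.
case: (boolP (walk v s)) => ws; last first.
  by rewrite mon_nwalk // pmul0l mon_nwalk ?if_same // walk_cat negb_and ws.
case: (boolP (walk w t)) => wt; last first.
  rewrite (@mon_nwalk l w) // pmul0r; case: eqP => // h.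
  by rewrite mon_nwalk // walk_cat negb_and h wt orbT.
have [p [vp sp ->]] := monP k ws; have [q [wq tq ->]] := monP l wt.
rewrite pmulU /pmul_basis; have := @pcat_some G p q.
rewrite {1 2}/pcat /mon /prng vp sp wq tq; case: eqP => // _ /(_ erefl).
Qed.

Lemma path_alg_ind (P : path_alg K G -> Prop) :
  P 0 -> (forall a b, P a -> P b -> P (a + b)) ->
  (forall k v s, walk v s -> P (mon k v s)) -> forall a, P a.
Proof.
move=> P0 PD Pm a; rewrite (monalgE a); elim/big_ind: _ => // p _.
by rewrite mon_gpath; apply: Pm; case: (p).
Qed.

Lemma pmulA a b c : a ** (b ** c) = (a ** b) ** c.
Proof.
pose g (x : K * vertex G * seq (edge G)) := mon x.1.1 x.1.2 x.2.
apply: (@associative_gen _ (@pmul K G) _ g) => [||P P0 PD Pg|]; [exact: pmulBl|exact: pmulBr| |].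
  by apply: path_alg_ind => // k v s _; exact: (Pg (k, v, s)).
move=> [[k v] s] [[l w] t] [[m x] r]; rewrite /g /=.
transitivity (mon k v s ** (if walk_end w t == x then mon (l * m) w (t ++ r) else 0)).
  by congr pmul; exact: mon_mul.
transitivity (pmul (if walk_end v s == w then mon (k * l) v (s ++ t) else 0) (mon m x r)); last first.
  by congr pmul; rewrite mon_mul.
case: (walk_end w t =P x) => tx; case: (walk_end v s =P w) => sw.
- apply: etrans (mon_mul k (l * m) v w s (t ++ r)) _.
  apply: etrans (esym (mon_mul (k * l) m v x (s ++ t) r)).
  by rewrite walk_end_cat sw tx 2!eqxx mulrA catA.
- apply: etrans (mon_mul _ _ _ _ _ _) _; apply: etrans (esym (pmul0l _)).
  by move/eqP/negPf: sw => ->.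
- apply: etrans (pmul0r _) (esym (etrans (mon_mul _ _ _ _ _ _) _)).
  by rewrite walk_end_cat sw; move/eqP/negPf: tx => ->.
- by apply: etrans (pmul0r _) (esym (pmul0l _)).
Qed.

End PathAlgebraTheory.

(** * Reduction of ideal elements to vertices *)

Lemma prefix_catP (T : eqType) (a b g : seq T) :
  seq.prefix a g -> seq.prefix b g -> (size a <= size b)%N -> seq.prefix a b.
Proof.
rewrite !prefixE => /eqP ag /eqP bg ab.
by rewrite -{1}bg take_takel // ag.
Qed.

(** If [c] went on after [s], its next edge would be an inner edge of [c] starting at [v]. *)
Lemma simple_closed_prefix (E : digraph) (v : vertex E) c s :
  simple_closed_path v c -> s <> [::] -> walk_end v s = v -> seq.prefix s c ->
  s = c.
Proof.
move=> [c0 wc ec simc] s0 es /prefixP[t ct]; case: t ct => [|e t] ct.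
  by rewrite ct cats0.
exfalso; move: wc; rewrite ct walk_cat /= es => /and3P[_ /eqP se _].
apply: (simc e) => //; rewrite ct; case: (s) s0 => //= f s' _.
by rewrite mem_cat mem_head orbT.
Qed.

(** Induction on the length: a closed path with an inner edge starting at [v] is cut before that
    edge. *)
Lemma simple_closed_ex (E : digraph) (v : vertex E) g :
  g <> [::] -> walk v g -> walk_end v g = v -> exists c, simple_closed_path v c.
Proof.
have [n] := ubnP (size g); elim: n g => // n IHn g gn g0 wg eg.
have [/allP simg|] := boolP (all (fun e => src e != v) (behead g)).
  by exists g; split=> // e /simg/eqP.
rewrite -has_predC => /hasP[e eb /=]; rewrite negbK => /eqP se.
case: g g0 wg eg eb gn => //= f g _ /andP[sf wg] eg eb gn.
case/splitPr: eb wg eg gn => s t wg eg gn; apply: (IHn (f :: s)) => //=.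
- by move: gn; rewrite size_cat /=; lia.
- by rewrite sf; move: wg; rewrite walk_cat => /andP[].
- by move: wg; rewrite walk_cat /= => /and3P[_ /eqP h _]; rewrite -[RHS]se h.
Qed.

Definition word_degree (E : digraph) (s : seq (edge (double_graph E))) : int :=
  \sum_(x <- s) edge_degree x.

(** The case of Condition (K) is derived from the identities below alone; [lpa_core_eq] applies it
    with [lpa K E] for [L] and [lpa_word] for [W]. *)
Section Reduction.
Variables (K : fieldType) (E : digraph).
Local Notation D := (double_graph E).
Variables (L : zmodType) (mul : L -> L -> L).
Local Notation "a ** b" := (mul a b) (at level 40, left associativity).
(* [W k v s] is the image in [L] of [k] times the path [s] starting at [v]. *)
Variable W : K -> vertex D -> seq (edge D) -> L.
Hypothesis mulBl : forall a a' b, (a - a') ** b = a ** b - a' ** b.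
Hypothesis mulBr : forall a b b', a ** (b - b') = a ** b - a ** b'.
Hypothesis mulA : forall a b c, a ** (b ** c) = a ** b ** c.
Hypothesis W_ind : forall P : L -> Prop,
  P 0 -> (forall a b, P a -> P b -> P (a + b)) ->
  (forall k v s, walk v s -> P (W k v s)) -> forall a, P a.
Hypothesis W_mul : forall k l v w s t,
  W k v s ** W l w t = if walk_end v s == w then W (k * l) v (s ++ t) else 0.
Hypothesis W_nwalk : forall k v s, ~~ walk v s -> W k v s = 0.
Hypothesis WD : forall k l v s, W (k + l) v s = W k v s + W l v s.
Hypothesis W_CK1 : forall e : edge E,
  W 1 (rng e) [:: inr e; inl e] = W 1 (rng e) [::].
Hypothesis W_CK1_neq : forall e f : edge E, e <> f ->
  W 1 (rng e) [:: inr e; inl f] = 0.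

Implicit Types (v u w : vertex E) (e f : edge E) (k l : K).
Implicit Types (al be ga de : seq (edge E)) (s : seq (edge D)).

Local Notation mul0l := (biadd0l mulBl).
Local Notation mul0r := (biadd0r mulBr).
Local Notation mulDl := (biaddDl mulBl).
Local Notation mulDr := (biaddDr mulBr).

Lemma mul_suml T (r : seq T) (P : pred T) (F : T -> L) x :
  (\sum_(i <- r | P i) F i) ** x = \sum_(i <- r | P i) F i ** x.
Proof. by elim/big_rec2: _ => [|i y z _ <-]; rewrite ?mul0l ?mulDl. Qed.

Lemma mul_sumr T (r : seq T) (P : pred T) (F : T -> L) x :
  x ** (\sum_(i <- r | P i) F i) = \sum_(i <- r | P i) x ** F i.
Proof. by elim/big_rec2: _ => [|i y z _ <-]; rewrite ?mul0r ?mulDr. Qed.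

Lemma W0 v s : W 0 v s = 0.
Proof. by apply: (addrI (W 0 v s)); rewrite -WD !addr0. Qed.

Lemma walk_end_inl u al : @walk_end D u (map inl al) = walk_end u al.
Proof. by rewrite /walk_end -map_comp. Qed.

Lemma walk_inl u al : @walk D u (map inl al) = walk u al.
Proof. by elim: al u => //= e al IH u; rewrite IH. Qed.

(** The test is needed: [s ++ t] can be a path although the longer word is not one. *)
Lemma W_reduce k v s e t : W k v (s ++ inr e :: inl e :: t) =
  if @walk_end D v s == rng e then W k v (s ++ t) else 0.
Proof.
have := W_mul k 1 v (rng e) s [:: inr e; inl e]; rewrite W_CK1 W_mul.
move=> /(congr1 (fun z => z ** W 1 (rng e) t)).
case: ifP => [/eqP h|h _].
  by rewrite !W_mul !walk_end_cat h /walk_end /= eqxx !mulr1 cats0 -catA /= => ->.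
by rewrite W_nwalk // walk_cat /= eq_sym h andbF.
Qed.

Lemma W_reduce_neq k v s e f t : e <> f -> W k v (s ++ inr e :: inl f :: t) = 0.
Proof.
move=> ef; have := W_mul k 1 v (rng e) s [:: inr e; inl f].
rewrite W_CK1_neq // mul0r => /(congr1 (fun z => z ** W 1 (rng f) t)).
rewrite mul0l; case: ifP => [/eqP h|h _].
  by rewrite W_mul walk_end_cat h /walk_end /= eqxx !mulr1 -catA /= => <-.
by rewrite W_nwalk // walk_cat /= eq_sym h andbF.
Qed.

(* The multiple [k al] of a real path, and the ghost path [be^*]. *)
Definition Wr k u al := W k u (map inl al).
Definition Wg u be := W 1 (walk_end u be) (rev (map inr be)).

Lemma Wr_mul k l u w al be :
  Wr k u al ** Wr l w be = if walk_end u al == w then Wr (k * l) u (al ++ be) else 0.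
Proof. by rewrite /Wr W_mul walk_end_inl map_cat. Qed.

Lemma Wr_nwalk k u al : ~~ walk u al -> Wr k u al = 0.
Proof. by move=> h; rewrite /Wr W_nwalk // walk_inl. Qed.

Lemma walk_end_ghost u be : walk u be ->
  @walk_end D (walk_end u be) (rev (map inr be)) = u.
Proof.
elim: be u => //= e be IH u /andP[/eqP <- wb].
by rewrite rev_cons -cats1 walk_end_cat.
Qed.

Lemma Wg_cons_mul u e be k al : walk u (e :: be) -> walk u (e :: al) ->
  Wg u (e :: be) ** Wr k u (e :: al) = Wg (rng e) be ** Wr k (rng e) al.
Proof.
move=> /= /andP[/eqP <- wb] /andP[_ wa].
rewrite /Wg /Wr /= rev_cons -cats1 !W_mul walk_end_cat /= eqxx.
have h := walk_end_ghost wb.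
by rewrite -catA /= W_reduce h /= eqxx.
Qed.

Lemma Wg_prefix u be k al : walk u be -> walk u (be ++ al) ->
  Wg u be ** Wr k u (be ++ al) = Wr k (walk_end u be) al.
Proof.
elim: be u => [|e be IH] u.
  by move=> _ wa; rewrite /Wg /Wr W_mul eqxx mul1r.
move=> we wea; rewrite cat_cons Wg_cons_mul // IH //.
- by case/andP: we.
- by case/andP: wea.
Qed.

(** The common initial edges cancel by [e^* e = r(e)]; at the first disagreement [e^* f = 0]. *)
Lemma Wg_incomparable u be k al : walk u be -> walk u al ->
  ~~ seq.prefix be al -> ~~ seq.prefix al be -> Wg u be ** Wr k u al = 0.
Proof.
elim: be u al => [|e be IH] u [|f al] //=.
move=> wb wa; case: (e =P f) => [ef|ef].
  rewrite -ef in wa *; rewrite !eqxx /= => n1 n2; rewrite Wg_cons_mul // IH //.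
  - by case/andP: wb.
  - by case/andP: wa.
move=> _ _; rewrite /Wg /Wr W_mul; case: ifP => // _.
by rewrite rev_cons -cats1 -catA /= W_reduce_neq.
Qed.


(** * Linear combinations of real paths *)

Definition rsum u (S : seq (seq (edge E) * K)) : L := \sum_(t <- S) Wr t.2 u t.1.

(** A formal combination of real paths from [u] to [w], without repetitions or zero coefficients, so
    that the length of the list counts summands and can serve for induction. *)
Definition reduced u w (S : seq (seq (edge E) * K)) : Prop :=
  uniq (unzip1 S) /\
  forall t, t \in S -> [/\ walk u t.1, walk_end u t.1 = w & t.2 != 0].

Lemma rsum_cons u t S : rsum u (t :: S) = Wr t.2 u t.1 + rsum u S.
Proof. by rewrite /rsum big_cons. Qed.

Lemma reduced_nil u w : reduced u w [::].
Proof. by []. Qed.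

Lemma reduced_cons u w t S : reduced u w (t :: S) <->
  [/\ t.1 \notin unzip1 S, walk u t.1, walk_end u t.1 = w, t.2 != 0 & reduced u w S].
Proof.
split=> [[/= /andP[tS uS] h]|[tS wt et t0 [uS h]]].
  have [|? ? ?] := h t; first exact: mem_head.
  by split=> //; split=> // t' t'S; apply: h; rewrite inE t'S orbT.
split=> [|t']; first by rewrite /= tS.
by rewrite inE => /orP[/eqP ->|/h].
Qed.

Lemma reduced_perm u w S t : t \in S -> reduced u w S ->
  rsum u S = rsum u (t :: rem t S) /\ reduced u w (t :: rem t S).
Proof.
move=> tS [uS h]; have p := perm_to_rem tS; split; first exact: perm_big.
split; first by rewrite -(perm_uniq (perm_map fst p)).
by move=> t' ht'; apply: h; rewrite (perm_mem p).
Qed.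

Lemma rsum_addl u w k al S : walk u al -> walk_end u al = w -> reduced u w S ->
  exists S', reduced u w S' /\ rsum u S' = Wr k u al + rsum u S.
Proof.
move=> wa ea rS; case: (k =P 0) => [->|/eqP k0].
  by exists S; split=> //; rewrite /Wr W0 add0r.
case: (boolP (al \in unzip1 S)) => [/mapP[t tS alt]|alS]; last first.
  by exists ((al, k) :: S); split; rewrite ?rsum_cons //; apply/reduced_cons.
have [-> /reduced_cons[nt _ _ _ rS']] := reduced_perm tS rS.
rewrite rsum_cons addrA -alt /Wr -WD; rewrite -alt in nt.
case: (k + t.2 =P 0) => [->|/eqP kt].
  by exists (rem t S); rewrite W0 add0r.
by exists ((al, k + t.2) :: rem t S); split; rewrite ?rsum_cons //; apply/reduced_cons.
Qed.

Lemma rsumD u w S1 S2 : reduced u w S1 -> reduced u w S2 ->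
  exists S, reduced u w S /\ rsum u S = rsum u S1 + rsum u S2.
Proof.
elim: S1 => [|t S1 IH]; first by exists S2; rewrite [rsum u [::]]big_nil add0r.
move=> /reduced_cons[_ wt et _ r1] r2; have [S [rS eS]] := IH r1 r2.
have [S' [rS' eS']] := rsum_addl t.2 wt et rS.
by exists S'; split=> //; rewrite eS' eS rsum_cons addrA.
Qed.

(* The expansion of [de^* (sum of S)]. *)
Definition strip de (S : seq (seq (edge E) * K)) :=
  [seq (drop (size de) t.1, t.2) | t <- S & seq.prefix de t.1].

Lemma size_strip de S : (size (strip de S) <= size S)%N.
Proof. by rewrite size_map size_filter count_size. Qed.

Lemma strip_reduced u w de S : walk u de -> reduced u w S ->
  reduced (walk_end u de) w (strip de S).
Proof.
move=> wd; elim: S => // t S IH /reduced_cons[tS wt et t0 rS].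
rewrite /strip /=; case: ifP => [/prefixP[ga tE]|_]; last exact: IH.
apply/reduced_cons; rewrite /= tE drop_size_cat //; split=> //; last exact: IH.
- apply: contra tS; rewrite /unzip1 -map_comp => /mapP[t' /=].
  rewrite mem_filter => /andP[/prefixP[ga' t'E] t'S].
  by rewrite t'E drop_size_cat // => gE; apply/mapP; exists t' => //; rewrite tE t'E gE.
- by move: wt; rewrite tE walk_cat => /andP[].
- by move: et; rewrite tE walk_end_cat.
Qed.

(** A summand that is a proper prefix of [de] would leave a ghost path, and is excluded. Every other
    summand either extends [de], which is stripped off, or is incomparable with it and killed. *)
Lemma Wg_rsum u w de S : walk u de -> reduced u w S ->
  (forall t, t \in S -> seq.prefix t.1 de -> seq.prefix de t.1) ->
  Wg u de ** rsum u S = rsum (walk_end u de) (strip de S).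
Proof.
move=> wd [_ h] nS; rewrite /rsum mul_sumr big_map big_filter [RHS]big_mkcond /=.
apply: eq_big_seq => t tS; have [wt _ _] := h t tS.
case: ifP => [/prefixP[ga tE]|/negbT n].
  by rewrite tE drop_size_cat // Wg_prefix // -tE.
by rewrite Wg_incomparable //; apply: contra n; apply: nS.
Qed.

Lemma shortest_ex (S : seq (seq (edge E) * K)) : S <> [::] ->
  exists2 t0, t0 \in S & forall t, t \in S -> (size t0.1 <= size t.1)%N.
Proof.
elim: S => // t [|t' S] IH _; first by exists t; rewrite ?mem_head // => x; rewrite inE => /eqP ->.
have [//|t0 t0S h] := IH; case: (leqP (size t.1) (size t0.1)) => tt.
  exists t; first exact: mem_head.
  by move=> x; rewrite inE => /orP[/eqP ->//|/h]; apply: leq_trans.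
exists t0; first by rewrite inE t0S orbT.
by move=> x; rewrite inE => /orP[/eqP ->|/h//]; apply: ltnW.
Qed.

(** The multiplier is [k^-1 al^*] for a summand [k al] of least length. No other summand is a prefix
    of [al], so nothing but real paths results, and only [al] itself becomes trivial. *)
Lemma rsum_normalize u w S : reduced u w S -> S <> [::] ->
  exists a S', [/\ reduced w w S', [::] \notin unzip1 S', (size S' < size S)%N
    & a ** rsum u S = Wr 1 w [::] + rsum w S'].
Proof.
move=> rS /shortest_ex[t0 t0S tmin].
have [-> /reduced_cons[nt wt et nz rR]] := reduced_perm t0S rS.
have szR : (size (rem t0 S) < size S)%N by rewrite size_rem // prednK //; case: (S) t0S.
exists (Wr t0.2^-1 w [::] ** Wg u t0.1), [seq (t.1, t0.2^-1 * t.2) | t <- strip t0.1 (rem t0 S)].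
have [uS' hS'] := strip_reduced wt rR; rewrite et in hS'.
have mapE : unzip1 [seq (t.1, t0.2^-1 * t.2) | t <- strip t0.1 (rem t0 S)]
          = unzip1 (strip t0.1 (rem t0 S)) by rewrite /unzip1 -map_comp.
split.
- split; first by rewrite mapE.
  by move=> _ /mapP[t /hS'[? ? ?] ->] /=; rewrite mulf_neq0 // invr_neq0.
- rewrite mapE; apply: contra nt; rewrite /unzip1 -map_comp => /mapP[t].
  rewrite mem_filter => /andP[/prefixP[ga tE] tR] /= /esym.
  rewrite tE drop_size_cat // => ga0; apply/mapP; exists t => //.
  by rewrite tE ga0 cats0.
- by rewrite size_map; apply: leq_ltn_trans (size_strip _ _) szR.
rewrite rsum_cons -mulA mulDr (Wg_rsum wt rR) ?et; last first.
  move=> t /mem_rem/tmin szt /prefixP[ga tE]; move: szt; rewrite tE size_cat.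
  case: ga tE => [|e ga] tE; last by rewrite /=; lia.
  by move=> _; rewrite cats0 prefix_refl.
have := @Wg_prefix u t0.1 t0.2 [::] wt; rewrite cats0 => -> //.
rewrite mulDr et Wr_mul /walk_end /= eqxx mulVf //; congr (_ + _).
rewrite /rsum mul_sumr [in RHS]big_map; apply: eq_bigr => t _.
by rewrite Wr_mul /walk_end /= eqxx.
Qed.


(** [J] stands for the largest graded ideal inside [I], and [degin P x] for the existence of a
    representative of [x] whose degrees all satisfy [P]. *)
Variables (I J : set L) (degin : pred int -> L -> Prop).
Hypothesis idI : two_sided_ideal mul I.
Hypothesis idJ : two_sided_ideal mul J.
Hypothesis JI : forall x, J x -> I x.
Hypothesis degin0 : forall P, degin P 0.
Hypothesis deginB : forall P x y, degin P x -> degin P y -> degin P (x - y).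
Hypothesis deginW : forall (P : pred int) k v s,
  P (word_degree s) -> degin P (W k v s).
Hypothesis J_comp : forall n x y,
  degin (pred1 n) x -> degin (predC1 n) y -> J (x + y) -> J x.
Hypothesis J_hom : forall n x, degin (pred1 n) x -> I x -> J x.

Lemma degin_sum (T : eqType) (r : seq T) (F : T -> L) P :
  (forall i, i \in r -> degin P (F i)) -> degin P (\sum_(i <- r) F i).
Proof.
move=> h; rewrite big_seq; elim/big_ind: _ => // x y dx dy.
by rewrite -[y]opprK; apply: (deginB dx); rewrite -sub0r; apply: deginB.
Qed.

Lemma word_degree_inl al : word_degree (map inl al : seq (edge D)) = (size al)%:Z.
Proof.
rewrite /word_degree big_map /= (eq_bigr (fun=> 1%:Z)) // big_const_seq count_predT.
by elim: (size al) => //= n ->; rewrite -PoszD.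
Qed.

Lemma degin_Wr (P : pred int) k u al : P (size al)%:Z -> degin P (Wr k u al).
Proof. by move=> h; apply: deginW; rewrite word_degree_inl. Qed.

Lemma rsum_mul u w be S : reduced u w S ->
  rsum u S ** Wr 1 w be = rsum u [seq (t.1 ++ be, t.2) | t <- S].
Proof.
move=> [_ h]; rewrite /rsum mul_suml big_map; apply: eq_big_seq => t /h[_ et _].
by rewrite Wr_mul et eqxx mulr1.
Qed.

(** All paths in [S] have positive length, so [be] is the component of degree [size be] of the
    product. *)
Lemma J_lead w be S : reduced w w S -> [::] \notin unzip1 S ->
  J ((Wr 1 w [::] + rsum w S) ** Wr 1 w be) -> J (Wr 1 w be).
Proof.
move=> rS nS; rewrite mulDl (rsum_mul _ rS) Wr_mul eqxx mulr1 cat0s.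
apply: (@J_comp (size be)); first by apply: degin_Wr => /=.
apply: degin_sum => _ /mapP[t tS ->] /=; apply: degin_Wr => /=.
rewrite size_cat; apply/negP => /eqP [/eqP]; rewrite -[X in _ == X]add0n eqn_add2r size_eq0.
by move=> /eqP t0; move/negP: nS; apply; apply/mapP; exists t.
Qed.

(** There are at least two simple closed paths at [w]. If both were prefixes of [ga], one would be a
    prefix of the other, hence equal to it. *)
Lemma other_simple_path w ga : condition_K E -> ga <> [::] -> walk w ga ->
  walk_end w ga = w -> exists2 c, simple_closed_path w c & ~~ seq.prefix c ga.
Proof.
move=> KE g0 wg eg; have [c sc] := simple_closed_ex g0 wg eg.
have [d [sd dc]] : exists d, simple_closed_path w d /\ d <> c.
  apply: contrapT => nd; apply: (KE w); exists c; split=> // d sd.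
  by apply: contrapT => cd; apply: nd; exists d; split=> // /esym.
case: (boolP (seq.prefix c ga)) => pc; last by exists c.
case: (boolP (seq.prefix d ga)) => pd; last by exists d.
exfalso; apply: dc; case/orP: (leq_total (size c) (size d)) => le.
  have [c0 _ ec _] := sc.
  by rewrite (simple_closed_prefix sd c0 ec (prefix_catP pc pd le)).
have [d0 _ ed _] := sd.
exact: (simple_closed_prefix sc d0 ed (prefix_catP pd pc le)).
Qed.

(* Conjugating [w + sum of closed paths] by a simple closed path [c] which is
   not a prefix of one of the summands keeps [w] and shortens the sum. *)
Lemma real_IJ : condition_K E -> forall u w S,
  reduced u w S -> I (rsum u S) -> J (rsum u S).
Proof.
move=> KE u w S; have [n] := ubnP (size S); elim: n u w S => // n IHn u w S szS rS IS.
case: (S =P [::]) => [->|/eqP/eqP S0]; first by rewrite /rsum big_nil; apply: ideal0 idJ.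
have [a [S' [rS' nS' szS' aE]]] := rsum_normalize rS S0.
have Iw : I (Wr 1 w [::] + rsum w S') by rewrite -aE; apply: (idealMl idI).
(* All summands of [S] end at [w], so [rsum u S] is a left multiple of [w]. *)
suff Jw : J (Wr 1 w [::]).
  have -> : rsum u S = rsum u S ** Wr 1 w [::].
    rewrite (rsum_mul _ rS) /rsum big_map; apply: eq_bigr => t _; by rewrite cats0.
  exact: (idealMl idJ).
case S'E: S' => [|t1 T] in aE Iw *.
  (* Without further summands, [w] itself is a homogeneous element of [I]. *)
  by move: Iw; rewrite /rsum big_nil addr0; apply: (@J_hom 0); exact: (@degin_Wr (pred1 0) 1 w [::]).
have t1S' : t1 \in S' by rewrite S'E mem_head.
have [wt1 et1 _] := rS'.2 t1 t1S'.
have t10 : t1.1 <> [::].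
  by move=> t10; move/negP: nS'; apply; apply/mapP; exists t1.
rewrite -S'E in Iw; have [c sc npc] := other_simple_path KE t10 wt1 et1.
have [c0 wc ec _] := sc.
pose S3 := [seq (t.1 ++ c, t.2) | t <- strip c S'].
have cE : Wg w c ** (Wr 1 w [::] + rsum w S') ** Wr 1 w c = Wr 1 w [::] + rsum w S3.
  rewrite mulDr (Wg_rsum wc rS'); last first.
    (* A summand of [S'] is a non-trivial closed path at [w], so it can be a prefix of [c] only by
       being [c]. *)
    move=> t tS' pt; have [_ et _] := rS'.2 t tS'.
    rewrite (@simple_closed_prefix _ w c t.1) ?prefix_refl // => t0.
    by move/negP: nS'; apply; apply/mapP; exists t.
  have rc := strip_reduced wc rS'; rewrite ec in rc *.
  rewrite mulDl (rsum_mul c rc) -mulA Wr_mul eqxx mulr1 cat0s; congr (_ + _).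
  by have := @Wg_prefix w c 1 [::] wc; rewrite cats0 ec => ->.
have rS3 : reduced w w S3.
  have := strip_reduced wc rS'; rewrite ec => -[uc hc]; split.
    have catK : cancel (cat^~ c) (fun be => take (size be - size c) be).
      by move=> x; rewrite size_cat addnK take_size_cat.
    rewrite /unzip1 /S3 -map_comp (eq_map (g := (cat^~ c) \o fst)) //.
    rewrite map_comp map_inj_uniq //.
    exact: can_inj catK.
  move=> _ /mapP[t /hc[wt et nt] ->] /=; split=> //.
    by rewrite walk_cat wt et.
  by rewrite walk_end_cat et.
have n3 : [::] \notin unzip1 S3.
  rewrite /unzip1 /S3 -map_comp; apply/mapP => -[t _ /=].
  by case: (t.1) => //= /esym.
(* Since [w] is the component of degree 0 of [w] plus [S3], it suffices that this sum lies in [J],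
   which the induction hypothesis gives. *)
apply: (J_lead rS3 n3); rewrite mulDl (rsum_mul _ rS3) Wr_mul eqxx mulr1.
have -> : [seq (t.1 ++ [::], t.2) | t <- S3] = S3.
  by rewrite -[RHS]map_id; apply: eq_map => -[x y]; rewrite /= cats0.
have -> : Wr 1 w [::] + rsum w S3 = rsum w (([::], 1) :: S3) by rewrite rsum_cons.
apply: (IHn w w).
(* The loss of [t1], which does not extend [c], makes up for the additional summand [w]; the strict
   decrease comes from [rsum_normalize]. *)
- apply: leq_trans (_ : (size S' < n)%N); last by apply: leq_trans szS' _.
  rewrite /= size_map /strip size_map size_filter ltnS S'E /= (negPf npc).
  by rewrite add0n ltnS count_size.
- by apply/reduced_cons; rewrite /walk_end /= oner_neq0.
- by rewrite rsum_cons -[_ + _]cE; apply: (Defs.idealMr idI); apply: (idealMl idI).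
Qed.


(** * Elimination of ghost edges *)

Lemma Wg1 w e : Wg w [:: e] = W 1 (rng e) [:: inr e].
Proof. by []. Qed.

(** Finite sums of vertices are local units. Admitting every larger set [U'] lets the sum of two
    elements use the union of their sets. *)
Lemma left_unit x : exists U : seq (vertex E), forall U', uniq U' ->
  {subset U <= U'} -> (\sum_(u <- U') Wr 1 u [::]) ** x = x.
Proof.
elim/W_ind: x => [|x y [U hU] [V hV]|k v s ws].
- by exists [::] => U' _ _; rewrite mul0r.
- exists (U ++ V) => U' uU' sub; rewrite mulDr hU ?hV // => z zU; apply: sub;
    by rewrite mem_cat zU ?orbT.
exists [:: v] => U' uU' /(_ v (mem_head _ _)) vU'.
rewrite mul_suml (bigD1_seq v) //= big1 ?addr0 => [|u /negPf uv].
  by rewrite /Wr W_mul /walk_end /= eqxx mul1r.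
by rewrite /Wr W_mul /walk_end /= uv.
Qed.

Lemma right_unit x : exists U : seq (vertex E), forall U', uniq U' ->
  {subset U <= U'} -> x ** (\sum_(u <- U') Wr 1 u [::]) = x.
Proof.
elim/W_ind: x => [|x y [U hU] [V hV]|k v s ws].
- by exists [::] => U' _ _; rewrite mul0l.
- exists (U ++ V) => U' uU' sub; rewrite mulDl hU ?hV // => z zU; apply: sub;
    by rewrite mem_cat zU ?orbT.
exists [:: @walk_end D v s] => U' uU' /(_ _ (mem_head _ _)) vU'.
rewrite mul_sumr (bigD1_seq (@walk_end D v s)) //= big1 ?addr0 => [|u /negPf uv].
  by rewrite /Wr W_mul eqxx mulr1 cats0.
by rewrite /Wr W_mul eq_sym uv.
Qed.

Lemma J_left x : (forall u, J (Wr 1 u [::] ** x)) -> J x.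
Proof.
move=> h; have [U hU] := left_unit x.
rewrite -(hU (undup U)) ?undup_uniq // => [|z]; last by rewrite mem_undup.
by rewrite mul_suml; apply: (ideal_sum idJ).
Qed.

Lemma J_right x : (forall u, J (x ** Wr 1 u [::])) -> J x.
Proof.
move=> h; have [U hU] := right_unit x.
rewrite -(hU (undup U)) ?undup_uniq // => [|z]; last by rewrite mem_undup.
by rewrite mul_sumr; apply: (ideal_sum idJ).
Qed.

(* The word [al be^*]. *)
Definition gword al be : seq (edge D) := map inl al ++ rev (map inr be).

Lemma gword_cons al f be : gword al (f :: be) = gword al be ++ [:: inr f].
Proof. by rewrite /gword /= rev_cons -cats1 catA. Qed.

(** A filtration of [L] by the length of the ghost parts, whose level 0 consists of the combinations
    of real paths. It is a predicate because an element may have several such expressions. *)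
Inductive ghost_le (N : nat) : L -> Prop :=
| ghost_le0 : ghost_le N 0
| ghost_leD x y : ghost_le N x -> ghost_le N y -> ghost_le N (x + y)
| ghost_leW k (u : vertex E) al be : (size be <= N)%N -> ghost_le N (W k u (gword al be)).

Lemma ghost_le_mono N M x : (N <= M)%N -> ghost_le N x -> ghost_le M x.
Proof.
move=> NM; elim=> [|y z _ hy _ hz|k u al be hb]; first exact: ghost_le0.
  exact: ghost_leD.
by apply: ghost_leW; apply: leq_trans NM.
Qed.

(** Induction from the right: a real edge appended to [al be^*] extends [al] if [be] is empty, and
    otherwise cancels the last ghost edge or gives 0. *)
Lemma W_normal k (v : vertex E) s : W k v s = 0 \/
  exists al be, W k v s = W k v (gword al be).
Proof.
elim/last_ind: s => [|s x IH]; first by right; exists [::], [::].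
case: (boolP (@walk_end D v s == src x)) => [sx|sx]; last first.
  by left; apply: W_nwalk; rewrite -cats1 walk_cat /= eq_sym (negPf sx) andbF.
have step : W k v (rcons s x) = W k v s ** W 1 (src x) [:: x].
  by rewrite W_mul sx mulr1 cats1.
case: IH => [s0|[al [be sE]]]; first by left; rewrite step s0 mul0l.
rewrite step sE W_mul mulr1; case: ifP => _; last by left.
case: x {sx step} => f; last by right; exists al, (f :: be); rewrite gword_cons.
case: be {sE} => [|g be].
  by right; exists (rcons al f), [::]; rewrite /gword /= !cats0 map_rcons cats1.
case: (g =P f) => [->|gf]; last by left; rewrite gword_cons -catA W_reduce_neq.
rewrite gword_cons -catA W_reduce; case: ifP => _; last by left.
by right; exists al, be; rewrite cats0.
Qed.

Lemma ghost_le_ex x : exists N, ghost_le N x.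
Proof.
elim/W_ind: x => [|x y [N hN] [M hM]|k v s _]; first by exists 0%N; apply: ghost_le0.
  exists (maxn N M); apply: ghost_leD.
    by apply: ghost_le_mono hN; exact: leq_maxl.
  by apply: ghost_le_mono hM; exact: leq_maxr.
have [->|[al [be ->]]] := W_normal k v s; first by exists 0%N; apply: ghost_le0.
by exists (size be); apply: ghost_leW.
Qed.

(** The edge [e] cancels the last ghost edge of a term or kills the term; a term without ghost edges
    stays in level 0. *)
Lemma ghost_le_edge N x w e : ghost_le N.+1 x -> ghost_le N (x ** Wr 1 w [:: e]).
Proof.
elim=> [|y z _ hy _ hz|k u al be hb]; first by rewrite mul0l; apply: ghost_le0.
  by rewrite mulDl; apply: ghost_leD.
rewrite /Wr W_mul; case: ifP => _; last exact: ghost_le0.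
case: be hb => [|f be] hb.
  have -> : gword al [::] ++ map inl [:: e] = gword (rcons al e) [::].
    by rewrite /gword /= !cats0 map_rcons cats1.
  exact: ghost_leW.
rewrite gword_cons -catA /=; case: (f =P e) => [->|fe].
  by rewrite W_reduce; case: ifP => _; rewrite ?cats0; [exact: ghost_leW|exact: ghost_le0].
by rewrite W_reduce_neq //; exact: ghost_le0.
Qed.

Lemma real_rsum y u w : ghost_le 0 y ->
  exists S, reduced u w S /\ Wr 1 u [::] ** y ** Wr 1 w [::] = rsum u S.
Proof.
elim=> [|x z _ [S1 [r1 E1]] _ [S2 [r2 E2]]|k v al be].
- by exists [::]; rewrite mul0r mul0l /rsum big_nil.
- have [S [rS ES]] := rsumD r1 r2.
  by exists S; split=> //; rewrite mulDr mulDl E1 E2 ES.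
rewrite leqn0 size_eq0 => /eqP ->; rewrite /gword cats0 -/(Wr k v al).
have nil0 : exists S, reduced u w S /\ 0 = rsum u S.
  by exists [::]; rewrite /rsum big_nil.
rewrite Wr_mul /walk_end /=; case: eqP => [_|_]; last by rewrite mul0l.
rewrite mul1r Wr_mul; case: eqP => // ew.
rewrite mulr1 cats0; case: (boolP (walk u al)) => wa; last by rewrite Wr_nwalk.
have [S [rS ES]] := rsum_addl k wa ew (reduced_nil u w).
by exists S; split=> //; rewrite ES /rsum big_nil addr0.
Qed.

(* The idempotent [w - sum_(e in F) e e^*]. *)
Definition gap w (F : seq (edge E)) : L :=
  Wr 1 w [::] - \sum_(e <- F) Wr 1 w [:: e] ** Wg w [:: e].

Section Gap.
Variables (w : vertex E) (F : seq (edge E)).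
Hypotheses (uF : uniq F) (sF : {in F, forall e, src e = w}).

(** For [f] in [F] the only surviving term of the sum is [f^* f f^* = f^*], which cancels [f^* w];
    for [f] not starting at [w], already [f^* w = 0]. *)
Lemma ghost_gap f : (src f = w -> f \in F) -> W 1 (rng f) [:: inr f] ** gap w F = 0.
Proof.
move=> fF; rewrite /gap mulBr mul_sumr; case: (src f =P w) => [fw|fw]; last first.
  have nw be : W 1 (rng f) [:: inr f] ** Wr 1 w be = 0.
    by rewrite /Wr W_mul /walk_end /=; case: eqP.
  by rewrite nw big1 ?subr0 // => e _; rewrite mulA nw mul0l.
have wf : walk w [:: f] by rewrite /= fw eqxx.
rewrite -(Wg1 w) (bigD1_seq f) ?fF //= big1_seq => [|e /andP[/eqP ef /sF se]].
  rewrite addr0 mulA; have := @Wg_prefix w [:: f] 1 [::] wf; rewrite cats0 => -> //.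
  rewrite Wg1 /Wr !W_mul /walk_end /= fw !eqxx !mulr1.
  by rewrite subrr.
rewrite mulA Wg_incomparable ?mul0l //= ?se ?eqxx //.
  by apply/negP => /andP[/eqP fe _]; apply: ef.
by apply/negP => /andP[/eqP fe _]; apply: ef.
Qed.

Lemma gap_Wr_in k e ga : e \in F -> gap w F ** Wr k w (e :: ga) = 0.
Proof.
move=> eF; case: (boolP (walk w (e :: ga))) => we; last by rewrite Wr_nwalk ?mul0r.
have se : walk w [:: e] by rewrite /= (sF eF) eqxx.
rewrite /gap mulBl mul_suml (bigD1_seq e) //= big1_seq ?addr0 => [|f /andP[/eqP fe /sF sf]].
  rewrite -mulA (@Wg_prefix w [:: e] k ga) // !Wr_mul /walk_end /= !eqxx !mul1r.
  by rewrite subrr.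
rewrite -mulA Wg_incomparable ?mul0r //= ?sf ?eqxx //.
  by apply/negP => /andP[/eqP fe' _]; apply: fe.
by apply/negP => /andP[/eqP fe' _]; apply: fe.
Qed.

Lemma gap_Wr_notin k e ga : e \notin F -> gap w F ** Wr k w (e :: ga) = Wr k w (e :: ga).
Proof.
move=> eF; case: (boolP (walk w (e :: ga))) => we; last by rewrite Wr_nwalk ?mul0r.
rewrite /gap mulBl mul_suml big1_seq ?subr0 => [|f /andP[_ fF]].
  by rewrite Wr_mul /walk_end /= eqxx mul1r.
have fe : f <> e by move=> fe; move: eF; rewrite -fe fF.
rewrite -mulA Wg_incomparable ?mul0r //= ?(sF fF) ?eqxx //.
  by apply/negP => /andP[/eqP fe' _]; apply: fe.
by apply/negP => /andP[/eqP fe' _]; apply: fe.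
Qed.

Lemma gap_idem : gap w F ** gap w F = gap w F.
Proof.
rewrite {2}/gap mulBr mul_sumr [X in _ - X]big1_seq => [|e /andP[_ eF]].
  rewrite subr0 /gap mulBl Wr_mul /walk_end /= eqxx mulr1 mul_suml.
  congr (_ - _); apply: eq_big_seq => e /sF se.
  by rewrite -mulA Wg1 /Wr W_mul /walk_end /= se eqxx mulr1.
by rewrite mulA gap_Wr_in // mul0l.
Qed.

Lemma vertex_gap : Wr 1 w [::] ** gap w F = gap w F.
Proof.
rewrite /gap mulBr mul_sumr Wr_mul /walk_end /= eqxx mulr1.
by congr (_ - _); apply: eq_bigr => e _; rewrite mulA Wr_mul /walk_end /= eqxx mulr1.
Qed.

Lemma degin_gap : degin (pred1 0) (gap w F).
Proof.
apply: deginB; first exact: (@degin_Wr (pred1 0) 1 w [::]).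
apply: degin_sum => e _; rewrite Wg1 /Wr W_mul; case: ifP => // _.
by apply: deginW; rewrite /word_degree /= big_cons big_seq1.
Qed.

End Gap.

(** The set [F0] collects the edges [f] leaving [w] for which [f^*] ends a ghost part of an
    expression of [x]. By [ghost_gap] all terms with a ghost part are killed; [y] is the sum of the
    others. *)
Lemma mul_gap N x w : ghost_le N x -> exists y (F0 : seq (edge E)),
  [/\ ghost_le 0 y, {in F0, forall e, src e = w} & forall F : seq (edge E), uniq F ->
      {in F, forall e, src e = w} -> {subset F0 <= F} -> x ** gap w F = y ** gap w F].
Proof.
elim=> [|x1 x2 _ [y1 [F1 [g1 s1 h1]]] _ [y2 [F2 [g2 s2 h2]]]|k u al [|f be] _].
- by exists 0, [::]; split=> //; exact: ghost_le0.
- exists (y1 + y2), (F1 ++ F2); split=> [|e|F uF sF sub]; first exact: ghost_leD.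
    by rewrite mem_cat => /orP[/s1|/s2].
  rewrite !mulDl h1 ?h2 // => e eF; apply: sub; by rewrite mem_cat eF ?orbT.
- by exists (W k u (gword al [::])), [::]; split=> //; apply: ghost_leW.
exists 0, (if src f == w then [:: f] else [::]).
split=> [|e|F uF sF sub]; first exact: ghost_le0.
  by case: eqP => // fw; rewrite inE => /eqP ->.
rewrite mul0l gword_cons.
have := W_mul k 1 u (rng f) (gword al be) [:: inr f].
case: ifP => [_|rf _]; last first.
  by rewrite W_nwalk ?mul0l // walk_cat /= eq_sym rf andbF.
rewrite mulr1 => <-; rewrite -mulA ghost_gap ?mul0r // => fw.
by apply: sub; rewrite fw eqxx mem_head.
Qed.

Lemma reduce_to_real : (forall y, ghost_le 0 y -> I y -> J y) ->
  forall N x, ghost_le N x -> I x -> J x.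
Proof.
move=> IJ0; elim=> [|N IHN] x gx Ix; first exact: IJ0.
apply: J_right => w.
(* Multiplication by an edge shortens the ghost parts, so the induction hypothesis applies. *)
have Jxe e : J (x ** Wr 1 w [:: e]).
  by apply: IHN; [exact: ghost_le_edge|exact: (Defs.idealMr idI)].
have [y [F0 [gy sF0 /(_ (undup F0) (undup_uniq _)) xy]]] := mul_gap w gx.
set F := undup F0 in xy.
have uF : uniq F := undup_uniq _.
have sF : {in F, forall e, src e = w} by move=> e; rewrite mem_undup => /sF0.
have {}xy : x ** gap w F = y ** gap w F.
  by apply: xy => // e; rewrite mem_undup.
(* The difference between [x w] and [x p], for [p] the gap, is the sum of the [x e e^*] with [e] in
   [F], which lies in [J] by [Jxe]. *)
suff Jz : J (x ** gap w F).
  have -> : x ** Wr 1 w [::] =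
      x ** gap w F + \sum_(e <- F) x ** Wr 1 w [:: e] ** Wg w [:: e].
    by rewrite /gap mulBr mul_sumr -[LHS](subrK (\sum_(e <- F) x ** (Wr 1 w [:: e] ** Wg w [:: e])));
      congr (_ + _); apply: eq_bigr => e _; rewrite mulA.
  apply: (idealD idJ Jz); apply: (ideal_sum idJ) => e _.
  exact: (Defs.idealMr idJ).
apply: J_left => u.
have [S [rS ES]] := real_rsum u w gy.
have zE : Wr 1 u [::] ** (x ** gap w F) = rsum u S ** gap w F.
  by rewrite -ES xy -{1}(vertex_gap w F) !mulA.
rewrite zE; case: (S =P [::]) => [->|S0].
  by rewrite /rsum big_nil mul0l; exact: ideal0 idJ.
have [a [S' [rS' nS' _ aE]]] := rsum_normalize rS S0.
(* For [e] outside [F] one has [p e = e], so [rsum u S] times [e] equals [u x e] and lies in [J];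
   then [J_lead] isolates [e]. *)
have Je e : e \notin F -> J (Wr 1 w [:: e]).
  move=> eF; apply: (J_lead rS' nS'); rewrite -aE -mulA; apply: (idealMl idJ).
  rewrite -(gap_Wr_notin sF 1 [::] eF) mulA -zE -mulA; apply: (idealMl idJ).
  by rewrite -mulA gap_Wr_notin.
have Ig : I (gap w F ** (Wr 1 w [::] + rsum w S') ** gap w F).
  rewrite -aE -!mulA; do 2!apply: (idealMl idI).
  by rewrite -zE; apply: (idealMl idI); exact: (Defs.idealMr idI).
(* Every path in [S'] has a first edge [e]: it is killed by [p] if [e] is in [F], and lies in [J]
   with [e] otherwise. *)
have Jg : J (gap w F ** rsum w S' ** gap w F).
  apply: (Defs.idealMr idJ); rewrite /rsum mul_sumr; apply: (ideal_sum_seq idJ).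
  move=> [[|e ga] k] tS' /=.
    by case/negP: nS'; apply/mapP; exists ([::], k).
  case: (boolP (e \in F)) => eF; first by rewrite gap_Wr_in //; exact: ideal0 idJ.
  rewrite gap_Wr_notin //; have := Wr_mul 1 k w (rng e) [:: e] ga.
  by rewrite /walk_end /= eqxx mul1r => <-; apply: (Defs.idealMr idJ); exact: Je.
suff Jw : J (gap w F) by exact: (idealMl idJ).
(* The gap [p] has degree 0, so it only has to lie in [I]; and [p = p w p] is
   [p (w + S') p - p S' p]. *)
apply: (J_hom (degin_gap w F)).
rewrite -gap_idem // -{1}[gap w F](_ : gap w F ** Wr 1 w [::] = _).
  have -> : gap w F ** Wr 1 w [::] ** gap w F =
     gap w F ** (Wr 1 w [::] + rsum w S') ** gap w F - gap w F ** rsum w S' ** gap w F.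
    by rewrite mulDr mulDl addrK.
  exact: (Defs.idealB idI Ig (JI Jg)).
rewrite /gap mulBl Wr_mul /walk_end /= eqxx mulr1 mul_suml.
congr (_ - _); apply: eq_big_seq => e /sF se.
by rewrite -mulA Wg1 /Wr W_mul /walk_end /= se eqxx mulr1.
Qed.

Lemma ideal_eq : condition_K E -> forall x, I x -> J x.
Proof.
move=> KE x; have [N gx] := ghost_le_ex x; apply: reduce_to_real gx.
move=> y gy Iy; apply: J_right => w; apply: J_left => u.
have [S [rS ES]] := real_rsum u w gy; rewrite mulA ES.
apply: (real_IJ KE rS); rewrite -ES.
by apply: (Defs.idealMr idI); exact: (idealMl idI).
Qed.

End Reduction.

(** * The grading *)

Section Grading.
Variables (K : fieldType) (E : digraph).
Local Notation D := (double_graph E).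
Local Notation A := (path_alg K D).
Local Notation "a ** b" := (@pmul K D a b) (at level 40).
Implicit Types (a b : A) (n m : int) (k : K).

Definition component n a : A :=
  [malg p in msupp a => if path_degree p == n then a@_p else 0].

Lemma componentE n a p : (component n a)@_p = if path_degree p == n then a@_p else 0.
Proof.
by rewrite mcoeffE; case: ifP => // /negbT /mcoeff_outdom ->; rewrite if_same.
Qed.

Lemma componentB n a b : component n (a - b) = component n a - component n b.
Proof.
apply/malgP => p; rewrite mcoeffB !componentE mcoeffB.
by case: ifP; rewrite ?subr0.
Qed.

Lemma component0 n : component n 0 = 0.
Proof. by rewrite -[X in component n X](subrr (0 : A)) componentB subrr. Qed.

Lemma componentD n a b : component n (a + b) = component n a + component n b.
Proof. by rewrite -{1}[b]opprK componentB -(sub0r b) componentB component0 sub0r opprK. Qed.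

Lemma component_mon n k v s :
  component n (mon k v s) = if word_degree s == n then mon k v s else 0.
Proof.
case: (boolP (walk v s)) => ws; last first.
  by rewrite (mon_nwalk _ ws) component0 if_same.
have [p [vp sp ->]] := monP k ws; apply/malgP => q.
rewrite componentE (fun_if (fun z : A => z@_q)) mcoeff0 mcoeffU.
case: (p =P q) => [<-|_]; last by rewrite mulr0n !if_same.
by rewrite /path_degree sp.
Qed.


Lemma word_degree_cat (s t : seq (edge D)) :
  word_degree (s ++ t) = word_degree s + word_degree t.
Proof. by rewrite /word_degree big_cat. Qed.

Lemma component_mon2 n k l v w (s t : seq (edge D)) :
  component n (mon k v s ** mon l w t) =
  if word_degree s + word_degree t == n then mon k v s ** mon l w t else 0.
Proof.
have -> : mon k v s ** mon l w t = _ := mon_mul k l v w s t.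
case: ifP => _; last by rewrite component0 if_same.
by rewrite component_mon word_degree_cat.
Qed.

Lemma component_mull n k v s b :
  component n (mon k v s ** b) = mon k v s ** component (n - word_degree s) b.
Proof.
elim/path_alg_ind: b => [|b b' IHb IHb'|l w t _].
- by rewrite component0 pmul0r component0.
- apply: etrans (congr1 _ (pmulDr b b' _)) (etrans (componentD _ _ _) _).
  apply: etrans (congr2 _ IHb IHb') (etrans (esym (pmulDr _ _ _)) _).
  by congr pmul; exact: esym (componentD _ _ _).
apply: etrans (component_mon2 _ _ _ _ _ _ _) _.
have -> : (word_degree s + word_degree t == n) = (word_degree t == n - word_degree s).
  by apply/eqP/eqP; lia.
by rewrite component_mon; case: ifP => // _; exact: esym (pmul0r _).
Qed.

Lemma component_mulr n k v s b :
  component n (b ** mon k v s) = component (n - word_degree s) b ** mon k v s.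
Proof.
elim/path_alg_ind: b => [|b b' IHb IHb'|l w t _].
- by rewrite component0 pmul0l component0.
- apply: etrans (congr1 _ (pmulDl b b' _)) (etrans (componentD _ _ _) _).
  apply: etrans (congr2 _ IHb IHb') (etrans (esym (pmulDl _ _ _)) _).
  by congr pmul; exact: esym (componentD _ _ _).
apply: etrans (component_mon2 _ _ _ _ _ _ _) _.
have -> : (word_degree t + word_degree s == n) = (word_degree t == n - word_degree s).
  by apply/eqP/eqP; lia.
by rewrite component_mon; case: ifP => // _; exact: esym (pmul0l _).
Qed.

(** The predicate [pred1 n] gives the homogeneous elements of degree [n], and [predC1 n] those
    without a component of degree [n]. *)
Definition degrees_in (P : pred int) a := forall n, ~~ P n -> component n a = 0.

Lemma degrees_in_sum P (T : Type) (r : seq T) (Q : pred T) (F : T -> A) :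
  (forall i, Q i -> degrees_in P (F i)) -> degrees_in P (\sum_(i <- r | Q i) F i).
Proof.
move=> h; elim/big_ind: _ => // [n _|x y dx dy n Pn]; first exact: component0.
by rewrite componentD dx // dy // addr0.
Qed.

Lemma degrees_inB (P : pred int) a b : degrees_in P a -> degrees_in P b -> degrees_in P (a - b).
Proof. by move=> da db n Pn; rewrite componentB da // db // subr0. Qed.

Lemma degrees_in_mon (P : pred int) k (v : vertex D) s : P (word_degree s) -> degrees_in P (mon k v s).
Proof.
move=> Ps n Pn; rewrite component_mon; case: eqP => // sn.
by rewrite -sn Ps in Pn.
Qed.

Lemma degrees_in_mon2 (P : pred int) k l v w (s t : seq (edge D)) :
  P (word_degree s + word_degree t) -> degrees_in P (mon k v s ** mon l w t).
Proof.
move=> Pst n Pn; rewrite component_mon2; case: eqP => // sn.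
by rewrite -sn Pst in Pn.
Qed.

Lemma degrees_in_supp (P : pred int) a :
  (forall p, p \in msupp a -> P (path_degree p)) -> degrees_in P a.
Proof.
move=> h n Pn; apply/malgP => p; rewrite componentE mcoeff0; case: eqP => // pn.
by apply: mcoeff_outdom; apply: contra Pn => /h; rewrite pn.
Qed.

Lemma component_id n a : degrees_in (pred1 n) a -> component n a = a.
Proof.
move=> da; apply/malgP => p; rewrite componentE; case: eqP => // /eqP pn.
by have := da _ pn => /(congr1 (fun z : A => z@_p)); rewrite componentE eqxx mcoeff0.
Qed.

Lemma component_sum a :
  a = \sum_(n <- undup [seq path_degree p | p <- msupp a]) component n a.
Proof.
apply/malgP => p; rewrite raddf_sum /=.
under eq_bigr do rewrite componentE.
case: (boolP (p \in msupp a)) => [pa|/mcoeff_outdom ->]; last first.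
  by rewrite big1 // => n _; rewrite if_same.
rewrite (bigD1_seq (path_degree p)) ?undup_uniq ?mem_undup ?map_f //= eqxx.
by rewrite big1 ?addr0 // => n; rewrite eq_sym => /negPf ->.
Qed.

Section GradedCore.
Variable I : set A.
Hypothesis idI : two_sided_ideal (@pmul K D) I.
Hypothesis rI : (@lpa_relation K E `<=` I)%classic.

(* The largest graded ideal contained in [I]. *)
Definition graded_core : set A := fun a => forall n, I (component n a).

(** Multiplication by a word shifts the components, and the words span the algebra. *)
Lemma graded_core_ideal : two_sided_ideal (@pmul K D) graded_core.
Proof.
have J0 : graded_core 0 by move=> n; rewrite component0; exact: ideal0 idI.
have JD x y : graded_core x -> graded_core y -> graded_core (x + y).
  by move=> Jx Jy n; rewrite componentD; apply: (idealD idI).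
split=> [//|x y Jx Jy n|r x Jx|r x Jx].
- by rewrite componentB; apply: (idealB idI).
- elim/path_alg_ind: r => [|a b Ja Jb|k v s _]; first by rewrite pmul0l.
    by rewrite pmulDl; apply: JD.
  by move=> n; rewrite component_mull; apply: (idealMl idI).
- elim/path_alg_ind: r => [|a b Ja Jb|k v s _]; first by rewrite pmul0r.
    by rewrite pmulDr; apply: JD.
  by move=> n; rewrite component_mulr; apply: (Defs.idealMr idI).
Qed.

Lemma graded_core_sub x : graded_core x -> I x.
Proof. by move=> Jx; rewrite (component_sum x); apply: (ideal_sum idI). Qed.

Lemma graded_core_hom n x : degrees_in (pred1 n) x -> I x -> graded_core x.
Proof.
move=> dx Ix m; case: (m =P n) => [->|/eqP mn]; first by rewrite component_id.
by rewrite dx //; exact: ideal0 idI.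
Qed.

Lemma graded_core_comp n x y : degrees_in (pred1 n) x -> degrees_in (predC1 n) y ->
  graded_core (x + y) -> graded_core x.
Proof.
move=> dx dy /(_ n); rewrite componentD component_id // (dy n) ?addr0 /= ?eqxx //.
exact: (graded_core_hom dx).
Qed.

Lemma pvert_mon v : @pvert K D v = mon 1 v [::].
Proof. by rewrite /pvert mon_gpath. Qed.

Lemma pedge_mon e : @pedge K D e = mon 1 (src e) [:: e].
Proof. by rewrite /pedge mon_gpath. Qed.

(** All defining relations are homogeneous of degree 0. Hence the core descends to the Leavitt path
    algebra. *)
Lemma graded_core_relation : (@lpa_relation K E `<=` graded_core)%classic.
Proof.
move=> x rx; apply: (@graded_core_hom 0); last exact: rI.
have gr e f : degrees_in (pred1 0) (pedge K (inr e : edge D) ** pedge K (inl f : edge D)).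
  rewrite 2!pedge_mon; apply: degrees_in_mon2.
  by rewrite /word_degree !big_seq1.
have rg e f : degrees_in (pred1 0) (pedge K (inl e : edge D) ** pedge K (inr f : edge D)).
  rewrite 2!pedge_mon; apply: degrees_in_mon2.
  by rewrite /word_degree !big_seq1.
have vx v : degrees_in (pred1 0) (@pvert K D v).
  by rewrite pvert_mon; apply: degrees_in_mon; rewrite /word_degree big_nil /=.
case: rx => [e|e f _|v _ _]; [exact: degrees_inB|exact: gr|].
by apply: degrees_inB => //; apply: degrees_in_sum.
Qed.

End GradedCore.
End Grading.

(** * Descent to the Leavitt path algebra, and the case of Condition (K) *)

Section LeavittTheory.
Variables (K : fieldType) (E : digraph).
Local Notation D := (double_graph E).
Local Notation A := (path_alg K D).
Local Notation L := (lpa K E).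
Local Notation pi := (@lpa_pi K E).
Local Notation mul := (@lpa_mul K E).

Lemma lpa_piB (a b : A) : pi (a - b) = pi a - pi b.
Proof. exact: (raddfB (\pi_(Quotient.quot (@in_lpa_ideal K E)))%qT). Qed.

Lemma lpa_pi0 : pi 0 = 0.
Proof. by rewrite -(subrr (0 : A)) lpa_piB subrr. Qed.

Lemma lpa_piD (a b : A) : pi (a + b) = pi a + pi b.
Proof. by rewrite -{1}[b]opprK lpa_piB -(sub0r b) lpa_piB lpa_pi0 sub0r opprK. Qed.

Lemma lpa_mulBl (x y z : L) : mul (x - y) z = mul x z - mul y z.
Proof.
rewrite -(lpa_piK x) -(lpa_piK y) -(lpa_piK z).
move: (lpa_repr x) (lpa_repr y) (lpa_repr z) => a b c.
rewrite -lpa_piB; apply: etrans (esym (lpa_piM _ _)) _.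
apply: etrans (congr1 _ (pmulBl a b c)) (etrans (lpa_piB _ _) _).
exact: congr2 (lpa_piM a c) (congr1 -%R (lpa_piM b c)).
Qed.

Lemma lpa_mulBr (z x y : L) : mul z (x - y) = mul z x - mul z y.
Proof.
rewrite -(lpa_piK x) -(lpa_piK y) -(lpa_piK z).
move: (lpa_repr x) (lpa_repr y) (lpa_repr z) => a b c.
rewrite -lpa_piB; apply: etrans (esym (lpa_piM _ _)) _.
apply: etrans (congr1 _ (pmulBr c a b)) (etrans (lpa_piB _ _) _).
exact: congr2 (lpa_piM c a) (congr1 -%R (lpa_piM c b)).
Qed.

Lemma lpa_mulA (x y z : L) : mul x (mul y z) = mul (mul x y) z.
Proof.
rewrite -(lpa_piK x) -(lpa_piK y) -(lpa_piK z).
move: (lpa_repr x) (lpa_repr y) (lpa_repr z) => a b c.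
apply: etrans (congr1 _ (esym (lpa_piM b c))) (etrans (esym (lpa_piM _ _)) _).
apply: etrans (congr1 _ (pmulA a b c)) (etrans (lpa_piM _ _) _).
exact: congr2 (lpa_piM a b) (erefl (pi c)).
Qed.

Lemma lpa_pi_rel a : lpa_relation a -> pi a = 0.
Proof. by move=> ra; rewrite -lpa_pi0; apply/lpa_pi_eq; rewrite subr0 => J [_]; apply. Qed.

(** As [N] contains the relations, it contains the ideal they generate, so membership does not
    depend on the representative. *)
Lemma lpa_descend (N : set A) : two_sided_ideal (@pmul K D) N ->
  (@lpa_relation K E `<=` N)%classic ->
  two_sided_ideal mul (fun x => N (lpa_repr x)) /\
  (forall a, N (lpa_repr (pi a)) <-> N a).
Proof.
move=> idN rN; have Npi a : N (lpa_repr (pi a)) <-> N a.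
  have Nab : N (lpa_repr (pi a) - a).
    have /lpa_pi_eq : pi (lpa_repr (pi a)) = pi a by rewrite lpa_piK.
    by apply; split.
  split=> h; last by rewrite -(subrK a (lpa_repr _)); exact: (idealD idN).
  by rewrite -[a](subKr (lpa_repr (pi a))); exact: (idealB idN).
split=> //; split=> [|x y|r x|r x].
- by rewrite -lpa_pi0; apply/Npi; exact: ideal0 idN.
- move=> Nx Ny; rewrite -(lpa_piK x) -(lpa_piK y) -lpa_piB.
  by apply/Npi; exact: (idealB idN).
- move=> Nx; rewrite -(lpa_piK x) -(lpa_piK r) -lpa_piM.
  by apply/Npi; exact: (idealMl idN).
- move=> Nx; rewrite -(lpa_piK x) -(lpa_piK r) -lpa_piM.
  by apply/Npi; exact: (Defs.idealMr idN).
Qed.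

Lemma lpa_pi_ideal (I : set L) : two_sided_ideal mul I ->
  two_sided_ideal (@pmul K D) (fun a => I (pi a)).
Proof.
move=> idI; split=> [|x y Ix Iy|r x Ix|r x Ix].
- by rewrite lpa_pi0; exact: ideal0 idI.
- by rewrite lpa_piB; apply: (idealB idI).
- by rewrite lpa_piM; apply: (idealMl idI).
- by rewrite lpa_piM; apply: (Defs.idealMr idI).
Qed.

(** The core is formed on the preimage of [I] in the path algebra, where components are read off the
    coefficients. *)
Definition lpa_core (I : set L) : set L :=
  fun x => graded_core (fun a => I (pi a)) (lpa_repr x).

Lemma lpa_core_descend (I : set L) : two_sided_ideal mul I ->
  two_sided_ideal mul (lpa_core I) /\
  (forall a, lpa_core I (pi a) <-> graded_core (fun b => I (pi b)) a).
Proof.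
move=> idI; have idI' := lpa_pi_ideal idI.
apply: lpa_descend; first exact: graded_core_ideal.
apply: graded_core_relation => // b /lpa_pi_rel ->; exact: ideal0 idI.
Qed.

Lemma lpa_core_ideal (I : set L) : two_sided_ideal mul I ->
  two_sided_ideal mul (lpa_core I).
Proof. by case/lpa_core_descend. Qed.

Lemma lpa_core_pi (I : set L) (a : A) : two_sided_ideal mul I ->
  lpa_core I (pi a) <-> graded_core (fun b => I (pi b)) a.
Proof. by case/lpa_core_descend. Qed.

Definition lpa_word k (v : vertex D) (s : seq (edge D)) : L := pi (mon k v s).

Definition lpa_degrees_in (P : pred int) (x : L) : Prop :=
  exists2 a, degrees_in P a & x = pi a.

Lemma lpa_word_ind (P : L -> Prop) : P 0 -> (forall x y, P x -> P y -> P (x + y)) ->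
  (forall k v s, walk v s -> P (lpa_word k v s)) -> forall x, P x.
Proof.
move=> P0 PD Pm x; rewrite -(lpa_piK x).
elim/path_alg_ind: (lpa_repr x) => [|a b Pa Pb|k v s ws].
- by rewrite lpa_pi0.
- by rewrite lpa_piD; apply: PD.
- exact: Pm.
Qed.

Lemma lpa_word_mul k l v w (s t : seq (edge D)) :
  mul (lpa_word k v s) (lpa_word l w t) =
  if walk_end v s == w then lpa_word (k * l) v (s ++ t) else 0.
Proof.
apply: etrans (esym (lpa_piM _ _)) _.
apply: etrans (congr1 _ (mon_mul k l v w s t)) _.
by case: ifP => // _; exact: lpa_pi0.
Qed.

Lemma lpa_word_nwalk k v s : ~~ walk v s -> lpa_word k v s = 0.
Proof. by move=> ws; rewrite /lpa_word mon_nwalk // lpa_pi0. Qed.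

Lemma lpa_wordD k l v s : lpa_word (k + l) v s = lpa_word k v s + lpa_word l v s.
Proof. by rewrite /lpa_word monD lpa_piD. Qed.

Lemma pedge_mul (e f : edge D) : rng e = src f ->
  pmul (pedge K e) (pedge K f) = mon 1 (src e) [:: e; f].
Proof.
move=> ef; rewrite 2!pedge_mon; apply: etrans (mon_mul _ _ _ _ _ _) _.
have -> : walk_end (src e) [:: e] == src f by apply/eqP; exact: ef.
by rewrite mulr1.
Qed.

Lemma lpa_word_CK1 (e : edge E) :
  lpa_word 1 (rng e) [:: inr e; inl e] = lpa_word 1 (rng e) [::].
Proof.
have := lpa_pi_rel (CK1_eq K e); rewrite lpa_piB pedge_mul // pvert_mon.
by move/eqP; rewrite subr_eq0 => /eqP.
Qed.

Lemma lpa_word_CK1_neq (e f : edge E) : e <> f ->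
  lpa_word 1 (rng e) [:: inr e; inl f] = 0.
Proof.
move=> ef; case: (src e =P src f) => [se|se].
  by have := lpa_pi_rel (CK1_neq K ef); rewrite pedge_mul.
by apply: lpa_word_nwalk; rewrite /= eqxx /=; apply/andP => -[/eqP fe _]; apply: se.
Qed.

Lemma lpa_core_sub (I : set L) x : two_sided_ideal mul I -> lpa_core I x -> I x.
Proof.
by move=> idI /(graded_core_sub (lpa_pi_ideal idI)); rewrite lpa_piK.
Qed.

Lemma lpa_core_hom (I : set L) n x : two_sided_ideal mul I ->
  lpa_degrees_in (pred1 n) x -> I x -> lpa_core I x.
Proof.
move=> idI [a da ->] Ia; apply/(lpa_core_pi _ idI).
exact: (graded_core_hom (lpa_pi_ideal idI) da).
Qed.

Lemma lpa_core_comp (I : set L) n x y : two_sided_ideal mul I ->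
  lpa_degrees_in (pred1 n) x -> lpa_degrees_in (predC1 n) y ->
  lpa_core I (x + y) -> lpa_core I x.
Proof.
move=> idI [a da ->] [b db ->]; rewrite -lpa_piD => /(lpa_core_pi _ idI) Jab.
by apply/(lpa_core_pi _ idI); exact: (graded_core_comp (lpa_pi_ideal idI) da db).
Qed.

Lemma lpa_degrees_in0 P : lpa_degrees_in P 0.
Proof. by exists 0; rewrite ?lpa_pi0 // => n _; rewrite component0. Qed.

Lemma lpa_degrees_inB (P : pred int) x y :
  lpa_degrees_in P x -> lpa_degrees_in P y -> lpa_degrees_in P (x - y).
Proof.
move=> [a da ->] [b db ->]; exists (a - b); rewrite ?lpa_piB //.
exact: degrees_inB.
Qed.

Lemma lpa_degrees_in_word (P : pred int) k v s :
  P (word_degree s) -> lpa_degrees_in P (lpa_word k v s).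
Proof. by move=> Ps; exists (mon k v s) => //; exact: degrees_in_mon. Qed.

Lemma lpa_core_eq (I : set L) x : two_sided_ideal mul I -> condition_K E ->
  I x -> lpa_core I x.
Proof.
move=> idI KE.
apply: (ideal_eq lpa_mulBl lpa_mulBr lpa_mulA lpa_word_ind lpa_word_mul
  lpa_word_nwalk lpa_wordD lpa_word_CK1 lpa_word_CK1_neq idI (lpa_core_ideal idI)
  (fun x => @lpa_core_sub I x idI) lpa_degrees_in0 lpa_degrees_inB
  lpa_degrees_in_word _ _ KE) => [n y z|n y].
  exact: lpa_core_comp.
exact: lpa_core_hom.
Qed.

(** The sum lies in the core of [I]. The summand [x n] is its part of degree [n], since the other
    summands have other degrees, and so it lies in the core too. *)
Lemma condition_K_homogeneous (I : set L) :
  condition_K E -> two_sided_ideal mul I -> homogeneous_ideal I.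
Proof.
move=> KE idI s x us hx /(lpa_core_eq idI KE) Js n ns.
apply: (lpa_core_sub idI); move: Js; rewrite (bigD1_seq n) //=.
have hd m (P : pred int) : m \in s -> P m -> lpa_degrees_in P (x m).
  move=> /hx[a ha ->] Pm; exists a => //; apply: degrees_in_supp => p /ha ->.
  exact: Pm.
apply: (@lpa_core_comp I n _ _ idI); first by apply: hd => //=.
rewrite big_seq_cond; elim/big_ind: _ => [|y z dy dz|m /andP[ms mn]].
- exact: lpa_degrees_in0.
- rewrite -[z]opprK; apply: lpa_degrees_inB => //; rewrite -sub0r.
  by apply: lpa_degrees_inB => //; exact: lpa_degrees_in0.
- exact: hd.
Qed.

End LeavittTheory.

(** * The module of infinite paths *)

Section Streams.
Variables (E : digraph) (v0 : vertex E).
Local Notation D := (double_graph E).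
Implicit Types (x y : nat -> edge E) (t : seq (edge D)) (e f : edge E).

Definition scons e x : nat -> edge E := fun n => if n is m.+1 then x m else e.

Definition recurrent x : Prop :=
  (forall n, rng (x n) = src (x n.+1)) /\
  (forall n, exists2 m, (n <= m)%N & src (x m) = v0).

Definition act1 (d : edge D) x : option (nat -> edge E) :=
  match d with
  | inl e => if rng e == src (x 0%N) then Some (scons e x) else None
  | inr e => if x 0%N == e then Some (fun n => x n.+1) else None
  end.

Definition act_word (s : seq (edge D)) x := foldr (fun d => obind (act1 d)) (Some x) s.

(** The test matters for the trivial path, which has to act as the projection onto the infinite
    paths starting at its vertex. *)
Definition act (v : vertex D) (s : seq (edge D)) x : option (nat -> edge E) :=
  if src (x 0%N) == @walk_end D v s then act_word s x else None.

Lemma recurrent_cons e x : recurrent x -> rng e = src (x 0%N) -> recurrent (scons e x).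
Proof.
move=> [cx rx] ex; split=> [[|n]//=|n]; have [m nm vm] := rx n.
by exists m.+1 => //; apply: leqW.
Qed.

Lemma recurrent_shift k x : recurrent x -> recurrent (fun n => x (k + n)%N).
Proof.
move=> [cx rx]; split=> [n|n]; first by rewrite addnS cx.
have [m nm vm] := rx (k + n)%N; exists (m - k)%N; first by lia.
by rewrite subnKC //; lia.
Qed.

Lemma act_word_recurrent s x y : recurrent x -> act_word s x = Some y -> recurrent y.
Proof.
move=> rx; elim: s y => [|d s IH] y /=; first by case=> <-.
case: (act_word s x) IH => //= z /(_ z erefl) rz.
case: d => e /=; case: eqP => // ez [<-]; first exact: recurrent_cons.
exact: (recurrent_shift 1).
Qed.

Lemma act_word_src w s x y : recurrent x -> walk w s ->
  act_word s x = Some y -> src (x 0%N) = @walk_end D w s -> src (y 0%N) = w.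
Proof.
move=> rx; elim: s w y => [|d s IH] w y /=; first by move=> _ [<-].
move=> /andP[/eqP <- ws]; case zE: (act_word s x) => [z|] //= dz xe.
have sz := IH _ _ ws zE xe; have [cz _] := act_word_recurrent rx zE.
case: d dz ws xe sz => e /=; case: eqP => // ez [<-] //= ws xe sz.
by rewrite -cz ez.
Qed.

Lemma act_cat v w s t x : recurrent x -> walk w t ->
  obind (act v s) (act w t x) =
  if @walk_end D v s == w then act v (s ++ t) x else None.
Proof.
move=> rx wt; rewrite /act walk_end_cat.
case: (@walk_end D v s =P w) => [->|sw]; case: eqP => //= xe.
  rewrite /act_word foldr_cat -/(act_word t x) -/(act_word s _).
  case tE: (act_word t x) => [y|] /=; first by rewrite (act_word_src rx wt tE xe) eqxx.
  by elim: s {xe} => //= d s <-.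
case tE: (act_word t x) => [y|] //=.
by rewrite (act_word_src rx wt tE xe); case: eqP => // /esym.
Qed.

Lemma act_real u (al : seq (edge E)) x : walk u al -> walk_end u al = src (x 0%N) ->
  exists y, act u (map inl al) x = Some y.
Proof.
move=> wa ex; rewrite /act walk_end_inl ex eqxx.
suff [y yE _] : exists2 y, act_word (map inl al) x = Some y & src (y 0%N) = u by exists y.
elim: al u wa ex => [|e al IH] u /=; first by move=> _ ux; exists x; [|exact: esym ux].
move=> /andP[/eqP <- wa] ex; have [y -> yE] := IH _ wa ex.
by exists (scons e y); rewrite //= yE eqxx.
Qed.

Lemma walk_mkseq x n : (forall n, rng (x n) = src (x n.+1)) ->
  walk (src (x 0%N)) (mkseq x n) /\ walk_end (src (x 0%N)) (mkseq x n) = src (x n).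
Proof.
move=> cx; elim: n => // n [wn en].
by rewrite mkseqS -cats1 walk_cat walk_end_cat wn en /= eqxx /walk_end /= cx.
Qed.

Section UniqueSimplePath.
Variable c : seq (edge E).
Hypothesis sc : simple_closed_path v0 c.
Hypothesis uc : forall s, simple_closed_path v0 s -> c = s.

(** Up to its first return to [v0], which exists by recurrence, [x] runs through a simple closed
    path, and [c] is the only one. *)
Lemma first_return x : recurrent x -> src (x 0%N) = v0 ->
  mkseq x (size c) = c /\ src (x (size c)) = v0.
Proof.
move=> [cx rx] x0.
have ex : exists n, (0 < n)%N && (src (x n) == v0).
  by have [m m0 /eqP vm] := rx 1%N; exists m; rewrite m0.
case: (ex_minnP ex) => n /andP[n0 /eqP vn] nmin.
have [wn en] := walk_mkseq n cx.
suff /uc cE : simple_closed_path v0 (mkseq x n) by rewrite {1 3}cE size_mkseq.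
split; [by case: (n) n0|by rewrite -x0|by rewrite -[in LHS]x0 en|].
move=> e; case: n n0 vn nmin wn en => // n _ _ nmin _ _.
rewrite /mkseq /= => /mapP[i]; rewrite mem_iota => /andP[i1 iN] -> vi.
by have := nmin i; rewrite vi eqxx i1 => /(_ isT); lia.
Qed.

(** Both paths begin with [c], and what follows is again recurrent and starts at [v0]; induction on
    the index. *)
Lemma recurrent_unique x y : recurrent x -> recurrent y ->
  src (x 0%N) = v0 -> src (y 0%N) = v0 -> x = y.
Proof.
move=> rx ry x0 y0; apply/funext => k.
have [n] := ubnP k; elim: n k x y rx ry x0 y0 => // n IHn k x y rx ry x0 y0 kn.
have [xc xv] := first_return rx x0; have [yc yv] := first_return ry y0.
have [c0 _ _ _] := sc.
case: (ltnP k (size c)) => kc.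
  by have := congr1 (fun s => nth (x k) s k) (etrans xc (esym yc)); rewrite /= !nth_mkseq.
have := IHn (k - size c)%N _ _ (recurrent_shift (size c) rx) (recurrent_shift (size c) ry).
rewrite !addn0 subnKC //; apply=> //.
have : (0 < size c)%N by case: (c) c0.
by lia.
Qed.

Lemma recurrent_ex : exists2 x, recurrent x & src (x 0%N) = v0.
Proof.
have [c0 wc ec _] := sc.
case: c c0 wc ec => // e0 c1 _; set d := e0 :: c1 => wd ed.
have n0 : (0 < size d)%N by [].
have src0 : src e0 = v0 by move: wd => /= /andP[/eqP].
have nthd u s i : walk u s -> (i < size s)%N ->
    rng (nth e0 s i) = if (i.+1 < size s)%N then src (nth e0 s i.+1) else walk_end u s.
  elim: s u i => // f s IH u [|i] /= /andP[_ ws] iN; last exact: (IH _ i ws).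
  by case: s {IH iN} ws => //= g s /andP[/eqP].
exists (fun n => nth e0 d (n %% size d)); last by rewrite mod0n.
split=> n; last first.
  by exists (n * size d)%N; [rewrite leq_pmulr|rewrite modnMl].
rewrite (nthd _ _ _ wd) ?ltn_pmod // -(addn1 n) -(modnDml n 1) addn1.
case: ltnP => iN; first by rewrite (modn_small iN).
(* Here the last edge of [c] is followed by the first one, which fits because [c] is closed. *)
have -> : (n %% size d).+1 = size d by apply/eqP; rewrite eqn_leq iN ltn_pmod.
by rewrite modnn ed.
Qed.

(** If [x] starts at [v0], then [c x] is another recurrent path from [v0], hence equal to [x];
    otherwise both sides are undefined. *)
Lemma act_cycle x : recurrent x -> act v0 (map inl c) x = act v0 [::] x.
Proof.
move=> rx; have [_ wc ec _] := sc.
rewrite /act walk_end_inl ec; case: eqP => // x0; rewrite [RHS]/=.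
have [y] := act_real wc (etrans ec (esym x0)).
rewrite /act walk_end_inl ec x0 eqxx => yE; rewrite yE; congr Some.
have ry := act_word_recurrent rx yE.
apply: recurrent_unique => //; apply: (@act_word_src _ _ _ _ rx _ yE).
  by rewrite walk_inl.
by rewrite walk_end_inl ec.
Qed.

End UniqueSimplePath.
End Streams.

(** * The annihilator of the module of infinite paths *)

Section StreamModule.
Variables (K : fieldType) (E : digraph) (v0 : vertex E).
Local Notation D := (double_graph E).
Local Notation A := (path_alg K D).
Local Notation "a ** b" := (@pmul K D a b) (at level 40).
Implicit Types (a b : A) (x : nat -> edge E) (F : (nat -> edge E) -> K).

(* The right action of the path algebra on functions on streams that is dual to
   the partial left action [act] of paths on streams. *)
Definition dual_act a F x : K :=
  \sum_(p <- msupp a) a@_p * oapp F 0 (act (psrc p) (psteps p) x).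

Lemma dual_actEw (S : {fset gpath D}) a F x : (msupp a `<=` S)%fset ->
  dual_act a F x = \sum_(p <- S) a@_p * oapp F 0 (act (psrc p) (psteps p) x).
Proof.
move=> aS; rewrite /dual_act (big_fset_incl _ aS) //= => p _ /mcoeff_outdom ->.
by rewrite mul0r.
Qed.

Lemma dual_actB a b F x : dual_act (a - b) F x = dual_act a F x - dual_act b F x.
Proof.
pose S := (msupp a `|` msupp b `|` msupp (a - b))%fset.
rewrite !(@dual_actEw S) ?fsubsetUr // /S -?fsetUA ?fsubsetUl //; last first.
  by rewrite fsetUCA fsubsetUl.
by rewrite -sumrB; apply: eq_bigr => p _; rewrite mcoeffB mulrBl.
Qed.

Lemma dual_act0 F x : dual_act 0 F x = 0.
Proof. by rewrite -(subrr (0 : A)) dual_actB subrr. Qed.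

Lemma dual_actD a b F x : dual_act (a + b) F x = dual_act a F x + dual_act b F x.
Proof. by rewrite -{1}[b]opprK dual_actB -(sub0r b) dual_actB dual_act0 sub0r opprK. Qed.

Lemma dual_act_sum T (r : seq T) (P : pred T) (f : T -> A) F x :
  dual_act (\sum_(i <- r | P i) f i) F x = \sum_(i <- r | P i) dual_act (f i) F x.
Proof. by elim/big_rec2: _ => [|i y z _ <-]; rewrite ?dual_act0 ?dual_actD. Qed.

Lemma dual_act_mon k v s F x : walk v s ->
  dual_act (mon k v s) F x = k * oapp F 0 (act v s x).
Proof.
move=> ws; have [p [<- <- ->]] := monP k ws.
by rewrite (@dual_actEw [fset p]%fset) ?msuppU_le // big_seq_fset1 mcoeffUU.
Qed.

Lemma dual_act_eq0 a F x : (forall y, F y = 0) -> dual_act a F x = 0.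
Proof.
move=> F0; rewrite /dual_act big1 // => p _.
by case: (act _ _ _) => [y|] /=; rewrite ?F0 mulr0.
Qed.

Lemma act_recurrent (v : vertex D) s x y : recurrent v0 x -> act v s x = Some y ->
  recurrent v0 y.
Proof. by move=> rx; rewrite /act; case: ifP => // _; exact: act_word_recurrent. Qed.

Lemma dual_act_ext a F F' x : recurrent v0 x ->
  (forall y, recurrent v0 y -> F y = F' y) -> dual_act a F x = dual_act a F' x.
Proof.
move=> rx FF'; apply: eq_bigr => p _; congr (_ * _).
by case aE: (act _ _ _) => [y|] //=; apply: FF'; exact: act_recurrent aE.
Qed.

Lemma dual_actDf a F F' x :
  dual_act a (fun y => F y + F' y) x = dual_act a F x + dual_act a F' x.
Proof.
rewrite /dual_act -big_split; apply: eq_bigr => p _ /=; rewrite -mulrDr; congr (_ * _).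
by case: (act _ _ _) => //=; rewrite addr0.
Qed.

Lemma dual_act_mul a b F x : recurrent v0 x ->
  dual_act (a ** b) F x = dual_act b (dual_act a F) x.
Proof.
move=> rx; elim/path_alg_ind: a => [|a a' IHa IHa'|k v s ws].
- by rewrite pmul0l dual_act0 dual_act_eq0 // => y; exact: dual_act0.
- apply: etrans (congr1 (fun z => dual_act z F x) (pmulDl a a' b)) _.
  apply: etrans (dual_actD _ _ _ _) (etrans (congr2 +%R IHa IHa') _).
  rewrite -dual_actDf; congr dual_act.
  by apply/funext => y; rewrite dual_actD.
elim/path_alg_ind: b => [|b b' IHb IHb'|l w t wt].
- by rewrite pmul0r !dual_act0.
- apply: etrans (congr1 (fun z => dual_act z F x) (pmulDr b b' _)) _.
  apply: etrans (dual_actD _ _ _ _) (etrans (congr2 +%R IHb IHb') _).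
  exact: esym (dual_actD _ _ _ _).
apply: etrans (congr1 (fun z => dual_act z F x) (mon_mul k l v w s t)) _.
rewrite [RHS]dual_act_mon //; have := act_cat v s rx wt.
have dm y : dual_act (mon k v s) F y = k * oapp F 0 (act v s y).
  exact: dual_act_mon.
case: ifP => [/eqP sw|_].
  rewrite dual_act_mon ?walk_cat ?ws ?sw // => <-.
  by case: (act w t x) => [y|] /=; rewrite ?dm ?mulr0 // mulrA (mulrC k).
by rewrite dual_act0; case: (act w t x) => [y|] /=; rewrite ?dm ?mulr0 // => -> /=; rewrite !mulr0.
Qed.

(** Vanishing against all functions [F] means annihilating the free module on the recurrent infinite
    paths. *)
Definition annihilator : set A :=
  fun a => forall F x, recurrent v0 x -> dual_act a F x = 0.

Lemma annihilator_ideal : two_sided_ideal (@pmul K D) annihilator.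
Proof.
split=> [F x _|a b Ia Ib F x rx|r a Ia F x rx|r a Ia F x rx].
- exact: dual_act0.
- by rewrite dual_actB Ia ?Ib ?subrr.
- by rewrite dual_act_mul // Ia.
- rewrite dual_act_mul // (@dual_act_ext _ _ (fun=> 0)) // ?dual_act_eq0 //.
  by move=> y ry; apply: Ia.
Qed.

Lemma dual_act_edge_ghost e F x : recurrent v0 x ->
  dual_act (pedge K (inl e : edge D) ** pedge K (inr e : edge D)) F x =
  if x 0%N == e then F x else 0.
Proof.
move=> [cx _]; rewrite pedge_mul // dual_act_mon ?mul1r /=; last by rewrite !eqxx.
rewrite /act /walk_end /=; case: (x 0%N =P e) => [xe|_] /=; last by case: ifP.
rewrite -cx xe !eqxx /=; congr F; apply/funext => -[|n] //=.
Qed.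

Lemma annihilator_relation : (@lpa_relation K E `<=` annihilator)%classic.
Proof.
move=> a ra F x rx; case: ra => [e|e f ef|v ns ni].
- rewrite dual_actB pedge_mul // pvert_mon !dual_act_mon //=; last by rewrite !eqxx.
  rewrite /act /walk_end /= eq_sym; case: eqP => xe; rewrite ?subrr //=.
  by rewrite eqxx /= subrr.
- case: (src e =P src f) => [se|se].
    rewrite pedge_mul // dual_act_mon /= ?se ?eqxx //.
    rewrite /act /walk_end /=; case: eqP => xe /=; last by rewrite mulr0.
    case: ifP => _ /=; last by rewrite mulr0.
    by case: eqP => [fe|_]; [case: ef|rewrite mulr0].
  rewrite 2!pedge_mon; apply: etrans (congr1 (fun z => dual_act z F x) (mon_mul _ _ _ _ _ _)) _.
  have -> : (@walk_end D (src (inr e : edge D)) [:: inr e] == src (inl f : edge D)) = false.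
    by apply/eqP.
  exact: dual_act0.
have fin : finite_set [set e : edge E | src e = v]%classic by exact: contrapT.
rewrite dual_actB fsbig_finite // dual_act_sum pvert_mon dual_act_mon // mul1r.
under eq_bigr do rewrite dual_act_edge_ghost //.
rewrite /act /walk_end /=; case: (src (x 0%N) =P v) => xv /=.
  (* Among the [e e^*] with [e] leaving [v], exactly the one of the first edge of [x] fixes [x]; the
     others kill it. *)
  rewrite (bigD1_seq (x 0%N)) ?fset_uniq //=; last first.
    by rewrite in_fset_set // inE.
  by rewrite eqxx big1 ?addr0 ?subrr // => e; rewrite eq_sym => /negPf ->.
rewrite big1_seq ?subrr // => e /andP[_]; rewrite in_fset_set // inE /= => ev.
by case: eqP => // xe; case: xv; rewrite xe.
Qed.

End StreamModule.

Lemma homogeneous_condition_K (K : fieldType) (E : digraph) :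
  (forall I : set (lpa K E),
     two_sided_ideal (@lpa_mul K E) I -> homogeneous_ideal I) -> condition_K E.
Proof.
move=> hI v0 [c [sc uc]]; set D := double_graph E.
pose N := @annihilator K E v0; have idN : two_sided_ideal (@pmul K D) N.
  exact: annihilator_ideal.
have [idI Npi] := lpa_descend idN (@annihilator_relation K E v0).
pose I : set (lpa K E) := fun x => N (lpa_repr x).
have [c0 wc ec _] := sc.
have n0 : (size c)%:Z != 0 by case: (c) c0.
pose cD : seq (edge D) := map inl c.
have wcD : walk (v0 : vertex D) cD by rewrite walk_inl.
(* These are the homogeneous summands of [v0 - c], in degrees 0 and [size c], which differ because
   [c] is non-empty. *)
pose y (n : int) : lpa K E :=
  if n == 0 then lpa_pi (mon 1 (v0 : vertex D) [::]) else lpa_pi (- mon 1 (v0 : vertex D) cD).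
have hom (k : K) (v : vertex D) s : walk v s ->
    forall p, p \in msupp (mon k v s) -> path_degree p = word_degree s.
  move=> ws p; have [q [_ qs ->]] := monP k ws.
  by move=> /(fsubsetP msuppU_le); rewrite inE => /eqP ->; rewrite /path_degree qs.
have [x rx xv] := recurrent_ex sc.
(* Homogeneity would put [v0] itself into the annihilator, but [v0] fixes [x], as the constant
   function 1 detects. *)
suff Iv : I (y 0).
  have /Npi/(_ (fun=> 1) x rx) : I (lpa_pi (mon 1 (v0 : vertex D) [::])) by [].
  rewrite dual_act_mon // /act /walk_end /= xv eqxx mul1r => /eqP.
  by rewrite oner_eq0.
apply: (hI I idI [:: 0; (size c)%:Z] y).
- by rewrite /= inE eq_sym n0.
- move=> n; rewrite !inE => /orP[/eqP ->|/eqP ->]; rewrite /y ?eqxx ?(negPf n0).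
    exists (mon 1 (v0 : vertex D) [::]) => // p /(hom 1 v0 [::] isT) ->.
    by rewrite /word_degree big_nil.
  exists (- mon 1 (v0 : vertex D) cD) => // p; rewrite msuppN => /(hom _ _ _ wcD) ->.
  exact: word_degree_inl.
- rewrite big_cons big_seq1 /y eqxx (negPf n0) -lpa_piD; apply/Npi => F z rz.
  rewrite dual_actB !dual_act_mon // /cD (act_cycle sc uc rz).
  by rewrite subrr.
- by rewrite inE eqxx.
Qed.

Theorem theorem3p8 (K : fieldType) (E : digraph) :
  (forall I : set (lpa K E),
     two_sided_ideal (@lpa_mul K E) I -> homogeneous_ideal I)
  <-> condition_K E.
Proof.
split; first exact: homogeneous_condition_K.
by move=> KE I; exact: condition_K_homogeneous.
Qed.
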